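(* For every positive integer $d$ there exists $v(d)>0$, and for every $\alpha\in(0,1)$ there exists $\beta=\beta(d,\alpha)>0$, such that the following holds. Let $\mathcal{F}$ be a family of $n$ convex sets in $\mathbb{R}^d$ such that at least $\alpha\binom{n}{d+1}$ of the $(d+1)$-element subfamilies $\{A_1,\dots,A_{d+1}\}\subseteq\mathcal{F}$ satisfy $\mathrm{vol}(A_1\cap\dots\cap A_{d+1})\ge1$. Then one can find at least $\beta n$ members of $\mathcal{F}$ whose common intersection has volume at least $v(d)$.
   Context: $\mathrm{vol}$ denotes $d$-dimensional Lebesgue measure.
   Formalization: The family is assumed to have n ≥ d+1 members; for 1 ≤ n ≤ d the hypothesis on (d+1)-element subfamilies is vacuous and the claim fails, for example when all the sets are empty. *)

(* Defs.v *)
From HB Require Import structures.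
From mathcomp Require Import all_boot all_order all_algebra.
From mathcomp Require Import all_classical all_reals.
From mathcomp Require Import ereal topology normedtype sequences convex.
Set Implicit Arguments. Unset Strict Implicit. Unset Printing Implicit Defensive.
Import Order.TTheory GRing.Theory Num.Theory.
Local Open Scope classical_set_scope.
Local Open Scope ring_scope.

Definition box (R : realType) (d : nat) (a b : 'rV[R]_d) : set 'rV[R]_d :=
  [set x | forall i : 'I_d, a ord0 i <= x ord0 i <= b ord0 i].

(* its elementary volume (used only when a <= b coordinatewise) *)
Definition box_vol (R : realType) (d : nat) (a b : 'rV[R]_d) : R :=
  \prod_(i < d) (b ord0 i - a ord0 i).

(* d-dimensional Lebesgue (outer) measure:
   vol A = inf { sum_k vol(B_k) | A is covered by countably many boxes B_k }.
   On Lebesgue measurable sets (in particular convex sets and their finite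
   intersections) this is the Lebesgue measure. *)
Definition vol (R : realType) (d : nat) (A : set 'rV[R]_d) : \bar R :=
  ereal_inf [set (\sum_(0 <= k <oo) (box_vol (ab k).1 (ab k).2)%:E)%E
            | ab in [set ab : nat -> 'rV[R]_d * 'rV[R]_d |
                 (forall k (i : 'I_d), (ab k).1 ord0 i <= (ab k).2 ord0 i) /\
                 A `<=` \bigcup_k box (ab k).1 (ab k).2]].

Definition bigcapS (R : realType) (d n : nat) (F : 'I_n -> set 'rV[R]_d)
  (S : {set 'I_n}) : set 'rV[R]_d :=
  \bigcap_(i in [set i | i \in S]) F i.

(* Main.v *)
Require Import Defs.
From HB Require Import structures.
From mathcomp Require Import all_boot all_order all_algebra.
From mathcomp Require Import all_classical all_reals.
From mathcomp Require Import ereal topology normedtype sequences convex.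
From mathcomp Require Import measure measurable_realfun lebesgue_measure.
From mathcomp Require Import lebesgue_integral numfun.
From mathcomp Require Import zify ring lra.
Import Order.TTheory GRing.Theory Num.Theory.
Local Open Scope classical_set_scope.
Local Open Scope ring_scope.

(** Call a convex set [K] of [R^(d+1)] fat with volume [V] when it has two
sections [K_s], [K_u] ([s < u]) orthogonal to the first axis which are, in
dimension [d], fat with volume [V / (u - s)]. Up to factors depending on [d]
only, a convex set is fat with volume [V] if and only if its volume is at least
[V], so that volumes can be replaced by fatness.

The heart of the proof is a dimension reduction. Let a positive proportion of
the [m]-tuples of sets have a fat intersection, so that each of them owns an
interval of levels, of length [l] say, at whose ends the intersection has a
section of volume at least [V / l]. A median argument on these intervals, along
paths changing one set of the tuple at a time, yields a single interval
[[s, u]] and a positive proportion of tuples which, after the deletion of one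
set, have all their sections at levels in [[s, u]] fat with volume
[c V / (u - s)]. The constant [c] does not depend on the proportion.

Applied repeatedly to [2^d]-tuples, this gives a fractional Helly theorem: a
positive proportion of fat [2^d]-tuples produces a fat set common to a positive
proportion of the family. To go from [(d+1)]-tuples to [2^d]-tuples, a dense
[(d+1)]-uniform hypergraph contains a positive proportion of complete
[(d+1)]-partite ones with large classes; in such a configuration the reduction
and an induction on [d] at several levels of [[s, u]] give many sets of one
class with fat sections at two distinct levels, hence with a fat
intersection. *)

Set Implicit Arguments.
Unset Strict Implicit.

(** * Densities on finite types of words *)

Section Density.
Variable R : realType.

Definition dens (T : finType) (P : pred T) : R := #|P|%:R / #|T|%:R.

Lemma dens_ge0 (T : finType) (P : pred T) : 0 <= dens P.
Proof. by rewrite divr_ge0. Qed.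

Lemma dens_le (T : finType) (P Q : pred T) :
  (forall x, P x -> Q x) -> dens P <= dens Q.
Proof.
move=> PQ; rewrite ler_wpM2r ?invr_ge0// ler_nat.
by apply: subset_leq_card; apply/fintype.subsetP => x; exact: PQ.
Qed.

Lemma dens_gt0 (T : finType) (P : pred T) : 0 < dens P -> exists x, P x.
Proof.
move=> P0; have [|P_0] := pickP P; first by move=> x Px; exists x.
by move: P0; rewrite /dens (eq_card P_0) card0 mul0r ltxx.
Qed.

Lemma dens_bound (T : finType) (P : pred T) (c : R) :
  (0 < #|T|)%N -> (c <= dens P) = (c * #|T|%:R <= #|P|%:R).
Proof. by move=> T0; rewrite /dens ler_pdivlMr ?ltr0n. Qed.

Lemma dens_pigeon (T C : finType) (P : pred T) (Q : C -> pred T) :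
  0 < dens P -> (forall x, P x -> exists c, Q c x) ->
  exists c, dens P / #|C|%:R <= dens (Q c).
Proof.
move=> P0 PQ; have [x0 Px0] := dens_gt0 P0.
have C0 : (0 < #|C|)%N.
  by have [c _] := PQ _ Px0; apply/card_gt0P; exists c.
have T0 : (0 < #|T|)%N by apply/card_gt0P; exists x0.
apply: contrapT => /forallNP h.
have : (\sum_c dens (Q c) < \sum_(c : C) dens P / #|C|%:R)%R.
  have [c0 _] := PQ _ Px0.
  apply: ltr_sum; first by apply/hasP; exists c0; rewrite // mem_index_enum.
  by move=> c _; rewrite ltNge; apply/negP/h.
rewrite sumr_const. rewrite -[X in _ < X]mulr_natr divfK ?pnatr_eq0 -?lt0n//.
apply/negP; rewrite -leNgt /dens -mulr_suml ler_wpM2r ?invr_ge0//.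
rewrite -natr_sum ler_nat.
under eq_bigr do rewrite -sum1_card big_mkcond.
rewrite exchange_big/= -sum1_card big_mkcond; apply: leq_sum => x _.
case: ifP => // Px; have [c Qc] := PQ _ Px.
by rewrite (bigD1 c)//= ifT.
Qed.

Lemma card_sumb (T : finType) (P : pred T) : #|P| = (\sum_x P x)%N.
Proof. by rewrite -sum1_card big_mkcond. Qed.

(** * Redrawing letters of a random word *)

Section Resampling.
Variables (X A B : finType) (b : A -> B).
Hypothesis b_inj : injective b.

Definition putc (w : {ffun B -> X}) (x : {ffun A -> X}) : {ffun B -> X} :=
  [ffun z => if [pick a | b a == z] is Some a then x a else w z].

Lemma putcE w x a : putc w x (b a) = x a.
Proof.
rewrite ffunE; case: pickP => [a' /eqP/b_inj ->//|/(_ a)].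
by rewrite eqxx.
Qed.

Lemma putc_out w x z : (forall a, b a != z) -> putc w x z = w z.
Proof.
move=> hz; rewrite ffunE; case: pickP => // a /eqP az.
by have := hz a; rewrite az eqxx.
Qed.

(** Exchanges the letters of a word along [b] with those of an independent word. Being an
    involution, it preserves the uniform measure, so these letters may be redrawn. *)
Definition swapc (p : {ffun B -> X} * {ffun A -> X}) :=
  (putc p.1 p.2, [ffun a => p.1 (b a)]).

Lemma swapcK : involutive swapc.
Proof.
move=> [w x]; rewrite /swapc/=; congr (_, _); apply/ffunP => z.
  have [[a <-]|/forallNP hz] := pselect (exists a, b a = z).
    by rewrite putcE ffunE.
  have {}hz a : b a != z by apply/eqP.
  by rewrite !putc_out.
by rewrite ffunE putcE.
Qed.

Lemma sum_swapc (f : {ffun B -> X} -> {ffun A -> X} -> nat) :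
  (\sum_w \sum_x f w x = \sum_w \sum_x f (putc w x) [ffun a => w (b a)])%N.
Proof.
rewrite (pair_bigA _ f) (pair_bigA _ (fun w x => f (putc w x) _))/=.
by rewrite (reindex_inj (inv_inj swapcK)).
Qed.

Lemma dens_comp (S : pred {ffun A -> X}) : (0 < #|X|)%N ->
  dens (fun w : {ffun B -> X} => S [ffun a => w (b a)]) = dens S.
Proof.
move=> X0; apply/eqP.
have := sum_swapc (fun w x => S x); rewrite sum_nat_const => h.
have {}h : (#|{: {ffun B -> X}}| * #|S| =
   #|{: {ffun A -> X}}| * #|[pred w : {ffun B -> X} | S [ffun a => w (b a)]]|)%N.
  rewrite (card_sumb S) h (card_sumb [pred w : {ffun B -> X} | _]) big_distrr/=.
  by apply: eq_bigr => w _; rewrite sum_nat_const.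
have n0 (I : finType) : #|{: {ffun I -> X}}|%:R != 0 :> R.
  by rewrite card_ffun pnatr_eq0 expn_eq0 -leqn0 leqNgt X0.
by rewrite eqr_div// -!natrM mulnC -h mulnC.
Qed.

End Resampling.

Definition upd (X B : finType) (w : {ffun B -> X}) b (y : X) : {ffun B -> X} :=
  [ffun z => if z == b then y else w z].

Lemma sum_upd (X B : finType) (b : B) (P : pred {ffun B -> X}) :
  (\sum_w #|[pred y | P (upd w b y)]| = #|X| * #|P|)%N.
Proof.
under eq_bigr do rewrite card_sumb.
rewrite (pair_bigA _ (fun w y => nat_of_bool (P (upd w b y))))/=.
pose g (p : {ffun B -> X} * X) := (upd p.1 b p.2, p.1 b).
have gK : involutive g.
  move=> [w y]; rewrite /g/= ffunE eqxx; congr (_, _).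
  by apply/ffunP => z; rewrite !ffunE; case: eqP => // ->.
rewrite (reindex_inj (inv_inj gK))/=.
have E (p : {ffun B -> X} * X) : upd (g p).1 b (g p).2 = p.1.
  by have := gK p; rewrite {1}/g => /(congr1 fst).
under eq_bigr do rewrite E.
rewrite -(pair_bigA _ (fun w y => nat_of_bool (P w)))/=.
rewrite (card_sumb P) big_distrr/=; apply: eq_bigr => w _.
by rewrite sum_nat_const.
Qed.

(* Jensen's inequality for the power [#|A|], in the weak form given by
   Markov's inequality. *)
Lemma dens_resample (X A B : finType) (b : A -> B) (a0 : A)
    (P : pred {ffun B -> X}) : (0 < #|X|)%N -> injective b ->
  (forall w w' : {ffun B -> X},
     (forall z, (forall a, a != a0 -> b a != z) -> w z = w' z) ->
     P w = P w') ->
  (dens P / 2) ^+ #|A|.+1 <=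
  dens (fun w : {ffun B -> X} => [forall a, P (upd w (b a0) (w (b a)))]).
Proof.
move=> X0 b_inj Pind; set p := dens P.
have p0 : 0 <= p by exact: dens_ge0.
have XB0 : (0 < #|{: {ffun B -> X}}|)%N by rewrite card_ffun expn_gt0 X0.
pose N (w : {ffun B -> X}) := #|[pred y | P (upd w (b a0) y)]|.
(* [N w] has mean [p * #|X|], so by Markov a proportion at least [p / 2] of the words have [N w] at
   least half of this mean. *)
pose good := [pred w : {ffun B -> X} | p / 2 * #|X|%:R <= (N w)%:R].
have goodP : p / 2 * #|{: {ffun B -> X}}|%:R <= #|good|%:R.
  have := sum_upd (b a0) P; rewrite -/N => /(congr1 (fun n => n%:R : R)).
  rewrite natr_sum natrM.
  have -> : #|P|%:R = p * #|{: {ffun B -> X}}|%:R.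
    by rewrite /p/dens mulfVK// pnatr_eq0 -lt0n.
  have : \sum_w (N w)%:R <= \sum_w ((good w)%:R * #|X|%:R + p / 2 * #|X|%:R).
    apply: ler_sum => w _; case: (boolP (good w)) => gw.
      rewrite mul1r (@le_trans _ _ #|X|%:R) ?ler_nat ?max_card//.
      by rewrite lerDl !mulr_ge0.
    by rewrite mul0r add0r ltW// ltNge.
  have gE : \sum_w (good w)%:R = #|good|%:R :> R.
    by rewrite (card_sumb good) natr_sum.
  rewrite big_split/= -mulr_suml gE sumr_const.
  rewrite -[X in _ <= _ + X]mulr_natr.
  move=> h1 h2; rewrite h2 in h1; rewrite -(@ler_pM2l _ #|X|%:R) ?ltr0n//.
  move: h1; rewrite (@eq_card _ xpredT {: {ffun B -> X}})//; lra.
have : \sum_(w in good) (p / 2 * #|X|%:R) ^+ #|A| <=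
       \sum_w ((N w) ^ #|A|)%:R :> R.
  rewrite [leRHS](bigID good)/= -[leLHS]addr0 lerD ?sumr_ge0//.
  apply: ler_sum => w; rewrite inE => gw.
  by rewrite natrX; apply: lerXn2r; rewrite ?nnegrE ?mulr_ge0 ?invr_ge0.
rewrite sumr_const -[X in X <= _]mulr_natr.
have <- : #|[pred w | [forall a, P (upd w (b a0) (w (b a)))]]|%:R *
          #|X|%:R ^+ #|A| = \sum_w ((N w) ^ #|A|)%:R :> R.
  rewrite -natrX -natrM -natr_sum; congr (_%:R).
  (* [P] ignores the letters at [b a] for [a != a0]. Once the letters along [b] are redrawn, the
     conditions for the various [a] are therefore independent. *)
  have key w : (\sum_(x : {ffun A -> X})
      [forall a, P (upd (putc b w x) (b a0) (putc b w x (b a)))] =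
      N w ^ #|A|)%N.
    rewrite /N -card_ffun_on -[RHS]sum1_card [RHS]big_mkcond.
    apply: eq_bigr => x _.
    suff -> : [forall a, P (upd (putc b w x) (b a0) (putc b w x (b a)))] =
      (x \in ffun_on [pred y | P (upd w (b a0) y)]) by case: ifP.
    have h a : P (upd (putc b w x) (b a0) (putc b w x (b a))) =
        P (upd w (b a0) (x a)).
      apply: Pind => z hz; rewrite !ffunE; case: eqP => // zb.
        by rewrite -[RHS](putcE b_inj w x) ffunE.
      rewrite -[RHS](putc_out (b := b) w x) ?ffunE// => a'.
      have [->|/hz//] := eqVneq a' a0; apply/eqP => E; exact: zb.
    by apply/forallP/ffun_onP => H a; have := H a; rewrite ?h inE.
  have := sum_swapc b_inj
    (fun w x => nat_of_bool [forall a, P (upd w (b a0) (w (b a)))]).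
  under eq_bigr do rewrite sum_nat_const.
  rewrite -big_distrr/= -card_sumb card_ffun mulnC => ->.
  by under eq_bigr do rewrite key.
rewrite dens_bound// exprMn -mulrA => H.
rewrite -(@ler_pM2r _ (#|X|%:R ^+ #|A|)) ?exprn_gt0 ?ltr0n//.
apply: le_trans H; rewrite exprSr.
have : 0 <= (p / 2) ^+ #|A| * #|X|%:R ^+ #|A|.
  by rewrite mulr_ge0 ?exprn_ge0 ?divr_ge0.
by move=> /(ler_wpM2l) /(_ _ _ goodP); rewrite !mulrA; nra.
Qed.

(* The coordinates in [Theta * I] are released one [i : I] at a time, starting
   from the words using only the symbol [th0]. *)
Lemma dens_blowup (Theta I : finType) (th0 : Theta) (gamma : R) : 0 < gamma ->
  exists2 gamma' : R, 0 < gamma' &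
  forall (X : finType) (G : pred {ffun I -> X}), (0 < #|X|)%N ->
    gamma <= dens G ->
    gamma' <= dens (fun w : {ffun Theta * I -> X} =>
      [forall tau : {ffun I -> Theta}, G [ffun i => w (tau i, i)]]).
Proof.
move=> gamma0.
(* [S s] only tests the choices [tau] equal to [th0] off [s]: for [s] empty this is [G] on the
   letters at [(th0, i)], for [s] all of [I] it is the goal. *)
pose S (s : seq I) (X : finType) (G : pred {ffun I -> X}) :=
  fun w : {ffun Theta * I -> X} =>
  [forall tau : {ffun I -> Theta}, [forall i, (i \notin s) ==> (tau i == th0)]
     ==> G [ffun i => w (tau i, i)]].
suff [g g0 H] : exists2 g : R, 0 < g & forall (X : finType)
    (G : pred {ffun I -> X}), (0 < #|X|)%N -> gamma <= dens G ->
    g <= dens (S (enum I) X G).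
  exists g => // X G X0 /(H _ _ X0) /le_trans; apply.
  apply: dens_le => w /forallP Sw; apply/forallP => tau.
  apply: (implyP (Sw tau)); apply/forallP => i.
  by rewrite mem_enum.
elim: (enum I) (enum_uniq I) => [_|k s IH /=/andP[ks us]].
  exists gamma => // X G X0 /le_trans; apply.
  rewrite -(@dens_comp _ _ _ (fun i : I => (th0, i)) _ G X0) => [|? ? []//].
  apply: dens_le => w Gw; apply/forallP => tau; apply/implyP => /forallP h.
  suff -> : [ffun i => w (tau i, i)] = [ffun i => w (th0, i)] by [].
  by apply/ffunP => i; rewrite !ffunE (eqP (implyP (h i) isT)).
have {us}[g g0 H] := IH us.
exists ((g / 2) ^+ #|Theta|.+1) => [|X G X0 /(H _ _ X0) {}H].
  by rewrite exprn_gt0// divr_gt0.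
have b_inj : injective (fun th : Theta => (th, k)) by move=> ? ? [].
have := @dens_resample _ _ _ _ th0 (S s X G) X0 b_inj.
have Sind (w w' : {ffun Theta * I -> X}) :
    (forall z, (forall a, a != th0 -> (a, k) != z) -> w z = w' z) -> S s X G w = S s X G w'.
  move=> hw; apply: eq_forallb => tau.
  case: forallP => //= h; congr G; apply/ffunP => i; rewrite !ffunE.
  apply: hw => a ath; apply/eqP => -[Ea Ei].
  by move: ath; rewrite Ea -Ei (eqP (implyP (h k) ks)) eqxx.
move=> /(_ Sind) hS.
apply: (@le_trans _ _ ((dens (S s X G) / 2) ^+ #|Theta|.+1)).
  by rewrite lerXn2r ?nnegrE ?divr_ge0 ?dens_ge0 ?(ltW g0)// ler_wpM2r ?invr_ge0.
apply: (le_trans hS); apply: dens_le => w /forallP h.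
apply/forallP => tau; apply/implyP => /forallP htau.
(* Copying the letter at [(tau k, k)] into [(th0, k)] lets [tau'], which is allowed by [s], read the
   same word as [tau]. *)
pose tau' := [ffun i => if i == k then th0 else tau i].
have /forallP/(_ tau')/implyP := h (tau k).
have -> : [ffun i => upd w (th0, k) (w (tau k, k)) (tau' i, i)] =
    [ffun i => w (tau i, i)].
  apply/ffunP => i; rewrite !ffunE.
  by have [->|/negPf ik] := eqVneq i k; rewrite ?eqxx// xpair_eqE ik andbF.
apply; apply/forallP => i; apply/implyP => si; rewrite ffunE.
have [//|ik] := eqVneq i k.
by apply: (implyP (htau i)); rewrite in_cons negb_or ik.
Qed.

(** Union bound over the pairs of positions: two distinct ones carry the same letter with
    probability [1 / #|X|]. *)
Lemma dens_not_inj (X B : finType) : (0 < #|X|)%N ->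
  dens (fun w : {ffun B -> X} => ~~ injectiveb w) <= (#|B| ^ 2)%:R / #|X|%:R.
Proof.
move=> X0; set P := fun w : {ffun B -> X} => _.
have [P0|P0] := ltP 0 (dens P); last by apply: (le_trans P0); rewrite divr_ge0.
have := @dens_pigeon _ (B * B)%type P
  (fun c w => (c.1 != c.2) && (w c.1 == w c.2)) P0.
case=> [w /injectivePn[x [y xy wxy]]|[x y] /=].
  by exists (x, y) => /=; rewrite xy wxy eqxx.
have PB : (0 < #|{: B * B}|)%N by apply/card_gt0P; exists (x, y).
rewrite ler_pdivrMr ?ltr0n// card_prod mulnn mulrC => /le_trans.
apply; rewrite ler_wpM2l//; have [->|xy] := eqVneq x y.
  rewrite leNgt; apply/negP => h.
  have : 0 < #|X|%:R^-1 :> R by rewrite invr_gt0 ltr0n.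
  by move=> /lt_trans/(_ h)/dens_gt0 [w]; rewrite eqxx.
have b_inj : injective (fun c : bool => if c then x else y).
  by move=> [] [] // E; move: xy; rewrite E eqxx.
have := dens_comp b_inj (fun x : {ffun bool -> X} => x true == x false) X0.
rewrite (_ : (fun _ => _) = (fun w : {ffun B -> X} => w x == w y)) => [->|];
  last by apply/funext => w; rewrite !ffunE.
rewrite /dens card_ffun card_bool natrX ler_pdivrMr ?exprn_gt0 ?ltr0n//.
rewrite expr2 mulrA mulVf ?mul1r ?pnatr_eq0 -?lt0n// ler_nat.
rewrite -(size_codom (fun z : X => [ffun _ : bool => z])).
apply: leq_trans (card_size _); apply: subset_leq_card.
apply/fintype.subsetP => w; rewrite -[w \in _]/(w true == w false) => /eqP E.
apply/codomP; exists (w true); apply/ffunP => -[]; by rewrite ffunE.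
Qed.

Lemma dens_blowup_inj (Theta I : finType) (th0 : Theta) (gamma : R) :
  0 < gamma ->
  exists n0 : nat, forall (X : finType) (G : pred {ffun I -> X}),
    (n0 <= #|X|)%N -> gamma <= dens G ->
    exists2 w : Theta * I -> X, injective w &
      forall tau : {ffun I -> Theta}, G [ffun i => w (tau i, i)].
Proof.
move=> gamma0; have [g g0 H] := @dens_blowup Theta I th0 gamma gamma0.
pose b := #|{: Theta * I}|.
have [n0 n0P] : exists n0 : nat, (b ^ 2)%:R / g < n0%:R.
  by exists (Num.truncn ((b ^ 2)%:R / g)).+1; rewrite truncnS_gt.
exists n0 => X G n0X GX.
have X0 : (0 < #|X|)%N.
  apply: leq_trans n0X; rewrite -(ltr_nat R) (le_lt_trans _ n0P)//.
  by rewrite divr_ge0// ltW.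
apply: contrapT => /forall2NP h.
have := H _ _ X0 GX; apply/negP; rewrite -ltNge.
apply: (@le_lt_trans _ _ ((b ^ 2)%:R / #|X|%:R)).
  apply: le_trans (dens_not_inj _ X0); apply: dens_le => w /forallP Gw.
  by apply/negP => /injectiveP w_inj; have [] := h w.
rewrite ltr_pdivrMr ?ltr0n// mulrC -ltr_pdivrMr//.
by apply: (lt_le_trans n0P); rewrite ler_nat.
Qed.

(** [D] maximises the number of ordered adjacent pairs inside it minus [q * n / 2] per vertex. The
    whole of [V] gives a positive value, so [D] is not empty; deleting [x] loses at most twice its
    degree, so by maximality this degree is at least [q * n / 4]. *)
Lemma dense_core (V : finType) (r : rel V) :
  symmetric r -> 0 < dens (fun p : V * V => r p.1 p.2) ->
  exists D : {set V}, D != finset.set0 /\ forall x, x \in D ->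
    dens (fun p : V * V => r p.1 p.2) / 4 <=
    dens (fun y => (y \in D) && r x y).
Proof.
move=> r_sym; set q := dens _ => q0.
have V0 : (0 < #|V|)%N.
  have [p _] := dens_gt0 q0; by apply/card_gt0P; exists p.1.
pose n : R := #|V|%:R.
have n0 : 0 < n by rewrite ltr0n.
pose deg (D : {set V}) x := (\sum_(y in D) r x y)%N.
pose e (D : {set V}) := (\sum_(x in D) deg D x)%N.
pose f (D : {set V}) : R := (e D)%:R - q * n / 2 * #|D|%:R.
pose D := [arg max_(D > (@finset.set0 V)) f D]%O.
have fD (E : {set V}) : f E <= f D.
  by rewrite /D; case: Order.TotalTheory.arg_maxP => // ? _; apply.
exists D; split.
  apply/eqP => D0; have := fD [set: V]%SET; rewrite D0 /f /e big_set0 cards0.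
  rewrite mulr0 subrr cardsT; apply/negP; rewrite -ltNge subr_gt0.
  have -> : (\sum_(x in [set: V]%SET) deg [set: V]%SET x)%N =
      #|[pred p : V * V | r p.1 p.2]|.
    rewrite (card_sumb [pred p : V * V | r p.1 p.2]).
    rewrite -(pair_bigA _ (fun x y => nat_of_bool (r x y)))/=.
    rewrite big_mkcond; apply: eq_bigr => x _.
    by rewrite inE /deg big_mkcond; apply: eq_bigr => y _; rewrite inE.
  have -> : #|[pred p : V * V | r p.1 p.2]|%:R = q * (n * n).
    by rewrite /q /dens card_prod natrM -/n divfK// mulf_neq0// gt_eqF.
  rewrite -/n; have : 0 < q * (n * n) by exact: mulr_gt0 q0 (mulr_gt0 n0 n0).
  lra.
move=> x xD; rewrite dens_bound// -/n.
have -> : #|[pred y | (y \in D) && r x y]| = deg D x.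
  rewrite /deg (card_sumb [pred y | (y \in D) && r x y]) [RHS]big_mkcond/=.
  by apply: eq_bigr => y _; case: (y \in D).
have := fD (D :\ x)%SET; rewrite /f (cardsD1 x D) xD.
have : (e D <= e (D :\ x)%SET + (deg D x).*2)%N.
  rewrite /e (big_setD1 x)//= -addnn addnCA leq_add2l.
  have -> : deg D x = (\sum_(y in D) r y x)%N.
    by rewrite /deg; apply: eq_bigr => y _; rewrite (r_sym x).
  rewrite [X in (_ <= _ + X)%N](big_setD1 x)//= addnCA.
  apply: leq_trans (leq_addl _ _); rewrite -big_split/=; apply: leq_sum => y _.
  by rewrite /deg (big_setD1 x)//= addnC.
rewrite -(ler_nat R) natrD -mul2n natrM natrD mulrDr mulr1.
lra.
Qed.

End Density.

(** * Fat convex sets *)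

Section Fat.
Variable R : realType.

Definition pcons d (x : R) (z : 'rV[R]_d) : 'rV[R]_d.+1 :=
  \row_j oapp (z ord0) x (unlift ord0 j).

Definition ptail d (p : 'rV[R]_d.+1) : 'rV[R]_d :=
  \row_i p ord0 (lift ord0 i).

Lemma pcons_head d x (z : 'rV[R]_d) : pcons x z ord0 ord0 = x.
Proof. by rewrite mxE unlift_none. Qed.

Lemma pcons_lift d x (z : 'rV[R]_d) i :
  pcons x z ord0 (lift ord0 i) = z ord0 i.
Proof. by rewrite mxE liftK. Qed.

Lemma pconsK d (p : 'rV[R]_d.+1) : pcons (p ord0 ord0) (ptail p) = p.
Proof.
apply/rowP => j; rewrite mxE; case: unliftP => [i ->|->//].
by rewrite /= mxE.
Qed.

Lemma pcons_affine d (a b x y : R) (z w : 'rV[R]_d) :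
  pcons (a * x + b * y) (a *: z + b *: w) = a *: pcons x z + b *: pcons y w.
Proof.
by apply/rowP => j; rewrite !mxE; case: unliftP => [i _|_] /=; rewrite ?mxE.
Qed.

Definition cvx d (K : set 'rV[R]_d) := forall p q (l : R),
  0 <= l <= 1 -> K p -> K q -> K ((1 - l) *: p + l *: q).

Definition sec d (K : set 'rV[R]_d.+1) (x : R) : set 'rV[R]_d :=
  [set z | K (pcons x z)].

Lemma cvx_bigcap d (I : Type) (D : set I) (F : I -> set 'rV[R]_d) :
  (forall i, cvx (F i)) -> cvx (\bigcap_(i in D) F i).
Proof.
by move=> cF p q l l01 Fp Fq i Di; apply: cF => //; [exact: Fp|exact: Fq].
Qed.

Lemma cvx_sec d (K : set 'rV[R]_d.+1) x : cvx K -> cvx (sec K x).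
Proof.
move=> cK z w l l01 Kz Kw; rewrite /sec/=.
have -> : x = (1 - l) * x + l * x by ring.
by rewrite pcons_affine; exact: cK.
Qed.

(* [fat K V] says that [K] contains the vertices of a combinatorial cube of
   volume at least [V] up to a constant: two parallel facets orthogonal to the
   first axis are themselves fat. *)
Fixpoint fat d : set 'rV[R]_d -> R -> Prop :=
  match d with
  | 0 => fun K V => K !=set0 /\ V <= 1
  | d'.+1 => fun K V => exists s u, [/\ s < u,
      fat (sec K s) (V / (u - s)) & fat (sec K u) (V / (u - s))]
  end.

Lemma fat_le d (K K' : set 'rV[R]_d) (V V' : R) :
  K `<=` K' -> V' <= V -> fat K V -> fat K' V'.
Proof.
elim: d => [|d IH] in K K' V V' *.
  by move=> KK' V'V [[z Kz] V1]; split; [exists z; exact: KK'|exact: le_trans V1].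
move=> KK' V'V [s [u [su fs fu]]]; exists s, u; split=> //.
  apply: IH fs; first by move=> z; exact: KK'.
  by rewrite ler_wpM2r// invr_ge0 subr_ge0 ltW.
apply: IH fu; first by move=> z; exact: KK'.
by rewrite ler_wpM2r// invr_ge0 subr_ge0 ltW.
Qed.

Lemma fat_nonempty d (K : set 'rV[R]_d) V : fat K V -> K !=set0.
Proof.
elim: d => [|d IH] in K V *; first by case.
by case=> s [u [_ /IH[z Kz] _]]; exists (pcons s z).
Qed.

Lemma fat_homothety d (K K' : set 'rV[R]_d) V (l : R) p : 0 < l ->
  (forall z, K z -> K' (l *: z + p)) -> fat K V -> fat K' (l ^+ d * V).
Proof.
move=> l0; elim: d => [|d IH] in K K' V p *.
  move=> KK' [[z Kz] V1]; rewrite expr0 mul1r; split=> //.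
  by exists (l *: z + p); exact: KK'.
move=> KK' [s [u [su fs fu]]].
exists (l * s + p ord0 ord0), (l * u + p ord0 ord0).
have -> : l * u + p ord0 ord0 - (l * s + p ord0 ord0) = l * (u - s) by ring.
have us0 : u - s != 0 by rewrite subr_eq0 gt_eqF.
have -> : l ^+ d.+1 * V / (l * (u - s)) = l ^+ d * (V / (u - s)).
  by rewrite exprS; field; rewrite us0 gt_eqF.
have key x z : sec K x z -> sec K' (l * x + p ord0 ord0) (l *: z + ptail p).
  move=> Kxz; rewrite /sec/=.
  have := pcons_affine l 1 x (p ord0 ord0) z (ptail p).
  by rewrite pconsK mul1r !scale1r => ->; exact: KK'.
split; first by rewrite ltrD2r ltr_pM2l.
  by apply: IH fs => z; exact: key.
by apply: IH fu => z; exact: key.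
Qed.

(** The cone of apex [pcons y z] over the section at [s] cuts the level [x] in a homothetic copy of
    that section, of ratio [1 - l], at least one half. *)
Lemma fat_toward d (K : set 'rV[R]_d.+1) (W l s y x : R) z : cvx K -> 0 <= W ->
  0 <= l <= 2^-1 -> K (pcons y z) -> x = (1 - l) * s + l * y ->
  fat (sec K s) W -> fat (sec K x) (2^-1 ^+ d * W).
Proof.
move=> cK W0 /andP[l0 l2] Ky -> fs.
have h : fat (sec K ((1 - l) * s + l * y)) ((1 - l) ^+ d * W).
  apply: (fat_homothety (p := l *: z)) fs => [|w Kw]; first by lra.
  by rewrite /sec/= pcons_affine; apply: cK => //; lra.
by apply: fat_le h => //; rewrite ler_wpM2r// lerXn2r ?nnegrE//; lra.
Qed.

(** The levels [x] from [s] to the midpoint of [s] and [y] are reached by [fat_toward] with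
    [l = (x - s) / (y - s)]. The denominator can vanish only when [x = s], where [l = 0] serves. *)
Lemma fat_between d (K : set 'rV[R]_d.+1) (W s y x : R) : cvx K -> 0 <= W ->
  sec K y !=set0 ->
  (s <= x /\ 2 * x <= s + y \/ x <= s /\ s + y <= 2 * x) ->
  fat (sec K s) W -> fat (sec K x) (2^-1 ^+ d * W).
Proof.
move=> cK W0 [z Kz] hx fs; have [xs|xs] := eqVneq x s.
  apply: (@fat_toward _ _ _ 0 s y _ z cK) => //; first by lra.
  by rewrite xs; ring.
have ys : y - s != 0.
  apply/eqP => ys; move/eqP: xs; lra.
apply: (@fat_toward _ _ _ ((x - s) / (y - s)) s y _ z cK) => //; last by field.
case: hx => -[h1 h2].
  have ys0 : 0 < y - s by rewrite lt0r ys; move/eqP: xs; lra.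
  apply/andP; split; first by rewrite divr_ge0//; lra.
  by rewrite ler_pdivrMr//; lra.
have ys0 : y - s < 0 by rewrite lt_neqAle ys; move/eqP: xs; lra.
rewrite -mulrNN -invrN !opprB; apply/andP; split.
  by rewrite divr_ge0//; lra.
by rewrite ler_pdivrMr; lra.
Qed.

End Fat.

(** * Slabs *)

Section Intervals.
Variable R : realType.

(** Length of the smallest interval containing [[l, r]] and [[l', r']]. *)
Definition hull (l r l' r' : R) := Num.max r r' - Num.min l l'.

Lemma hull_spec l r l' r' : let h := hull l r l' r' in
  [/\ r - l <= h, r - l' <= h, r' - l <= h & r' - l' <= h] /\
  [\/ h = r - l, h = r - l', h = r' - l | h = r' - l'].
Proof.
rewrite /hull; case: (leP r r') => ?; case: (leP l l') => ?.
- by split; [split; lra|constructor 3].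
- by split; [split; lra|constructor 4].
- by split; [split; lra|constructor 1].
- by split; [split; lra|constructor 2].
Qed.

(** As long as all steps are shorter than [rho], the hull with the initial interval grows by less
    than [rho] each time, hence stays below [m%:R * rho = delta / 4]. So some step is long, and up
    to the first long one the intervals remain near the initial one. *)
Lemma first_long_step (L U : nat -> R) (m : nat) (delta rho : R) :
  (forall k, L k <= U k) -> 0 < rho -> m%:R * rho = delta / 4 ->
  U 0 - L 0 <= delta -> delta / 4 <= hull (L 0) (U 0) (L m) (U m) ->
  (0 < m)%N ->
  exists k, [/\ (k < m)%N, rho <= hull (L k) (U k) (L k.+1) (U k.+1),
    L 0 - delta / 4 <= L k, U k <= U 0 + delta / 4 & U k - L k <= delta].
Proof.
move=> LU rho0 mrho UL0 hm m0.
(* The index 0 is apart: the hull of the initial interval with itself is its length, which need not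
   be 0. *)
pose Inv n := n = 0 \/ hull (L 0) (U 0) (L n) (U n) < n%:R * rho.
have step n : (n < m)%N -> Inv n ->
    rho <= hull (L n) (U n) (L n.+1) (U n.+1) \/ Inv n.+1.
  move=> nm In; have [?|h] := leP rho (hull (L n) (U n) (L n.+1) (U n.+1)).
    by left.
  right; right; case: In => [n0|In]; first by rewrite n0 mul1r; move: h; rewrite n0.
  have [[h1 h2 h3 h4] _] := hull_spec (L 0) (U 0) (L n) (U n).
  have [[i1 i2 i3 i4] _] := hull_spec (L n) (U n) (L n.+1) (U n.+1).
  have [_ E] := hull_spec (L 0) (U 0) (L n.+1) (U n.+1).
  have := LU n; rewrite -natr1 mulrDl mul1r; case: E => -> ?; lra.
suff [k [km Ik hk]] : exists k, [/\ (k < m)%N, Inv k &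
    rho <= hull (L k) (U k) (L k.+1) (U k.+1)].
  have d0 : 0 < delta.
    have : 0 < m%:R * rho by rewrite mulr_gt0 ?ltr0n.
    by rewrite mrho; lra.
  case: Ik => [k0|Ik]; first by exists k; split=> //; rewrite k0; lra.
  have kd : k%:R * rho <= delta / 4.
    by rewrite -mrho ler_wpM2r ?ler_nat ?(ltW rho0)// ltnW.
  have [[h1 h2 h3 h4] _] := hull_spec (L 0) (U 0) (L k) (U k).
  by have ? := LU k; have ? := LU 0; exists k; split=> //; lra.
apply: contrapT => /forallNP hn.
have all n : (n <= m)%N -> Inv n.
  elim: n => [|n IH nm]; first by left.
  have In := IH (ltnW nm); have [h|//] := step n nm In.
  by case: (hn n).
have [m_0|] := all m (leqnn m); first by rewrite m_0 in m0.
by rewrite mrho ltNge hm.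
Qed.

(** An interval can be shrunk to the extreme ends of the slabs it contains. This leaves finitely
    many candidates, whose ends are ends of slabs, and a shortest one exists. *)
Lemma short_interval (T : finType) (D : pred T) (l r : T -> R) (theta : R) :
  0 < theta -> theta <= dens R D ->
  exists a b, theta <= dens R (fun t => [&& D t, a <= l t & r t <= b]) /\
  forall a' b', theta <= dens R (fun t => [&& D t, a' <= l t & r t <= b']) ->
    b - a <= b' - a'.
Proof.
move=> th0 thD.
pose P (p : T * T) :=
  theta <= dens R (fun t => [&& D t, l p.1 <= l t & r t <= r p.2]).
have tight (S : pred T) : theta <= dens R S -> (forall t, S t -> D t) ->
    exists p, [/\ P p, S p.1 & S p.2].
  move=> thS SD; have [t0 St0] := dens_gt0 (lt_le_trans th0 thS).
  pose t1 := [arg min_(t < t0 | S t) l t]%O.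
  pose t2 := [arg max_(t > t0 | S t) r t]%O.
  have [St1 t1P] : S t1 /\ forall t, S t -> l t1 <= l t.
    by rewrite /t1; case: arg_minP => // t St h; split=> // t' /h.
  have [St2 t2P] : S t2 /\ forall t, S t -> r t <= r t2.
    by rewrite /t2; case: arg_maxP => // t St h; split=> // t' /h.
  exists (t1, t2); split=> //; apply: (le_trans thS); apply: dens_le => t St.
  by rewrite SD//= t1P// t2P.
have [p0 [Pp0 _ _]] := tight D thD (fun _ => id).
pose p := [arg min_(p < p0 | P p) (r p.2 - l p.1)]%O.
have [Pp pP] : P p /\ forall p', P p' -> r p.2 - l p.1 <= r p'.2 - l p'.1.
  by rewrite /p; case: arg_minP => // ? ? h; split=> // ? /h.
exists (l p.1), (r p.2); split=> // a b /tight[].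
  by move=> t /andP[].
move=> [t1 t2] /= [/pP/= h /and3P[_ at1 _] /and3P[_ _ t2b]].
lra.
Qed.

Lemma grid_cell (x0 y0 w : R) (N : nat) : 0 < w -> y0 <= x0 ->
  x0 + 2 * w <= y0 + N%:R * w ->
  exists c : 'I_N, x0 <= y0 + c%:R * w /\ y0 + (c%:R * w + w) <= x0 + 2 * w.
Proof.
move=> w0 yx xN; pose t := (x0 - y0) / w.
have t0 : 0 <= t by rewrite divr_ge0 ?subr_ge0// ltW.
have tw : t * w = x0 - y0 by rewrite divfK ?gt_eqF.
have t1 : (Num.truncn t)%:R <= t by rewrite truncn_le.
have t2 : t < (Num.truncn t).+1%:R by rewrite truncnS_gt.
have cN : ((Num.truncn t).+1 < N)%N.
  rewrite -(ltr_nat R) -(ltr_pM2r w0) -natr1.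
  have : (Num.truncn t)%:R * w <= t * w by rewrite ler_wpM2r// ltW.
  lra.
exists (Ordinal cN) => /=.
have : (Num.truncn t)%:R * w <= t * w by rewrite ler_wpM2r// ltW.
have : t * w < (Num.truncn t).+1%:R * w by rewrite ltr_pM2r.
rewrite -natr1; lra.
Qed.

(** If [[l, r]] is long, go inwards from [l] towards [r]. Otherwise the large hull forces [r'] to be
    well above [r] or [l'] well below [l], and one goes outwards from [r] or from [l]; [fat_between]
    keeps the sections fat on the way. *)
Lemma fat_next_to d (K : set 'rV[R]_d.+1) (V l r l' r' j delta rho : R) :
  cvx K -> 0 < V -> l < r ->
  fat (sec K l) (V / (r - l)) -> fat (sec K r) (V / (r - l)) ->
  sec K l' !=set0 -> sec K r' !=set0 -> 0 < rho <= delta / 4 ->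
  j - delta / 4 <= l -> r <= j + delta + delta / 4 -> r - l <= delta ->
  rho <= hull l r l' r' ->
  exists x0, [/\ j - delta / 2 <= x0, x0 + rho / 8 <= j + 3 / 2 * delta &
    forall x, x0 <= x <= x0 + rho / 8 ->
      fat (sec K x) (2^-1 ^+ d * (V / delta))].
Proof.
move=> cK V0 lr fl fr Kl Kr /andP[rho0 rhod] jl rj rl.
have W0 : 0 <= V / (r - l) by rewrite divr_ge0//; lra.
have bound x : fat (sec K x) (2^-1 ^+ d * (V / (r - l))) ->
    fat (sec K x) (2^-1 ^+ d * (V / delta)).
  apply: fat_le => //; rewrite ler_wpM2l ?exprn_ge0//.
  by rewrite ler_pM2l// lef_pV2 ?posrE//; lra.
have [h _|h hh] := leP (rho / 2) (r - l).
  exists l; split; [lra|lra|] => x /andP[lx xr]; apply: bound.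
  apply: (fat_between (y := r)) fl => //; first exact: fat_nonempty fr.
  by left; lra.
have [h1|h1] := leP (rho / 4) (r' - r).
  exists r; split; [lra|lra|] => x /andP[lx xr]; apply: bound.
  by apply: (fat_between (y := r')) fr => //; left; lra.
exists (l - rho / 8); split; [lra|lra|] => x /andP[lx xr]; apply: bound.
apply: (fat_between (y := l')) fl => //; right.
by have [_ E] := hull_spec l r l' r'; case: E => E; lra.
Qed.

End Intervals.

(** * Deleting one set *)

Section Descent.
Variable R : realType.
Local Notation dens := (dens R).

Lemma dens_union (T : finType) (P Q Q' : pred T) :
  (forall x, P x -> Q x || Q' x) -> dens P <= dens Q + dens Q'.
Proof.
move=> PQ; rewrite /dens -mulrDl ler_wpM2r ?invr_ge0// -natrD ler_nat.
rewrite (card_sumb P) (card_sumb Q) (card_sumb Q') -big_split/=.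
apply: leq_sum => x _; have := PQ x.
by case: (P x) => //; case: (Q x); case: (Q' x) => // /(_ isT).
Qed.

Lemma dens_pairs (T T' : finType) (P : pred T) (Q : T -> pred T') (a b : R) :
  0 <= a -> 0 <= b -> a <= dens P -> (forall x, P x -> b <= dens (Q x)) ->
  a * b <= dens (fun p : T * T' => P p.1 && Q p.1 p.2).
Proof.
move=> a0 b0 aP bQ; have [->|a_neq0] := eqVneq a 0.
  by rewrite mul0r dens_ge0.
have [x0 Px0] : exists x, P x.
  by apply: (@dens_gt0 R); apply: lt_le_trans aP; rewrite lt0r a_neq0.
have [->|b_neq0] := eqVneq b 0; first by rewrite mulr0 dens_ge0.
have [y0 _] : exists y, Q x0 y.
  apply: (@dens_gt0 R); apply: lt_le_trans (bQ _ Px0).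
  by rewrite lt0r b_neq0.
have T0 : (0 < #|T|)%N by apply/card_gt0P; exists x0.
have T'0 : (0 < #|T'|)%N by apply/card_gt0P; exists y0.
rewrite dens_bound// in aP.
have {}bQ x : P x -> b * #|T'|%:R <= #|Q x|%:R.
  by move=> /bQ; rewrite dens_bound.
rewrite dens_bound ?card_prod ?muln_gt0 ?T0// natrM mulrACA.
apply: (@le_trans _ _ (\sum_(x | P x) b * #|T'|%:R)).
  by rewrite sumr_const -[leRHS]mulr_natl ler_wpM2r// mulr_ge0.
apply: (@le_trans _ _ (\sum_(x | P x) #|Q x|%:R)); first exact: ler_sum.
rewrite -natr_sum ler_nat
  (card_sumb (fun p : T * T' => P p.1 && Q p.1 p.2)).
rewrite -(pair_bigA _ (fun x y => nat_of_bool (P x && Q x y)))/=.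
rewrite big_mkcond; apply: leq_sum => x _; case: ifP => // Px.
by rewrite (card_sumb (Q x)).
Qed.

Lemma dens_bij (T T' : finType) (f : T -> T') (P : pred T') :
  bijective f -> dens (fun x => P (f x)) = dens P.
Proof.
move=> f_bij; rewrite /dens (bij_eq_card f_bij); congr (_%:R / _).
have := card_preim (bij_inj f_bij) P.
rewrite (@eq_card _ (fun x => P (f x)) [preim f of P])// => ->.
apply: eq_card => x; rewrite inE/=.
have [g _ gK] := f_bij; rewrite -{1}(gK x) codom_f//.
Qed.

(** * Mixtures of two tuples *)

Section Mixing.
Variables (X I : finType).
Implicit Types T : {ffun I -> X}.

Definition mix (B : {set I}) T T' : {ffun I -> X} :=
  [ffun i => if i \in B then T' i else T i].

Let split (w : {ffun bool * I -> X}) :=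
  ([ffun i => w (false, i)] : {ffun I -> X},
   [ffun i => w (true, i)] : {ffun I -> X}).

Let split_bij : bijective split.
Proof.
exists (fun p : {ffun I -> X} * {ffun I -> X} =>
    [ffun z : bool * I => if z.1 then p.2 z.2 else p.1 z.2]).
  by move=> w; apply/ffunP => -[[] i]; rewrite !ffunE.
move=> [T T']; rewrite /split/=.
by congr (_, _); apply/ffunP => i; rewrite !ffunE.
Qed.

Let mix_split B w :
  mix B (split w).1 (split w).2 = [ffun i => w (i \in B, i)].
Proof. by apply/ffunP => i; rewrite !ffunE; case: (i \in B). Qed.

Lemma dens_mix (B : {set I}) (S : pred {ffun I -> X}) : (0 < #|X|)%N ->
  dens (fun p : {ffun I -> X} * {ffun I -> X} => S (mix B p.1 p.2)) = dens S.
Proof.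
move=> X0; rewrite -(dens_bij _ split_bij).
rewrite -(dens_comp R (b := fun i : I => (i \in B, i)) _ S X0) => [|i j []//].
by congr (dens _); apply/funext => w /=; rewrite mix_split.
Qed.

(** Adjacency of two tuples: replacing the entries of one by those of the other, in any order, never
    leaves [G]. *)
Definition all_mix (G : pred {ffun I -> X}) : rel {ffun I -> X} :=
  fun T T' => [forall B : {set I}, G (mix B T T')].

Lemma all_mix_sym G : symmetric (all_mix G).
Proof.
suff h T T' : all_mix G T T' -> all_mix G T' T.
  by move=> T T'; apply/idP/idP; exact: h.
move=> /forallP GT; apply/forallP => B.
suff -> : mix B T' T = mix (~: B)%SET T T' by [].
by apply/ffunP => i; rewrite !ffunE finset.in_setC; case: (i \in B).
Qed.

(** A pair of tuples is a word with two letters per coordinate, and a mixture is a choice of one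
    letter in each. Thus [dens_blowup] bounds the density of adjacent pairs from below. *)
Lemma dens_all_mix_split G :
  dens (fun p : {ffun I -> X} * {ffun I -> X} => all_mix G p.1 p.2) =
  dens (fun w : {ffun bool * I -> X} =>
    [forall tau : {ffun I -> bool}, G [ffun i => w (tau i, i)]]).
Proof.
rewrite -(dens_bij _ split_bij); congr (dens _); apply/funext => w.
apply/forallP/forallP => h tau.
  have := h [set i | tau i]%SET; rewrite mix_split.
  suff -> : [ffun i => w (i \in [set i | tau i]%SET, i)] =
    [ffun i => w (tau i, i)] by [].
  by apply/ffunP => i; rewrite !ffunE finset.inE.
rewrite mix_split; have := h [ffun i => i \in tau].
suff -> : [ffun i => w ([ffun i => i \in tau] i, i)] =
  [ffun i => w (i \in tau, i)] by [].
by apply/ffunP => i; rewrite !ffunE.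
Qed.

End Mixing.

(** Deleting a set of the tuple means removing its index from [A]; words keep their length, so
    densities stay comparable. [F] may depend on the index, which accommodates partite
    configurations and their sections. *)
Definition cap d (X I : finType) (F : I -> X -> set 'rV[R]_d) (A : {set I})
    (T : {ffun I -> X}) : set 'rV[R]_d :=
  [set p | forall i, i \in A -> F i (T i) p].

Lemma cvx_cap d (X I : finType) (F : I -> X -> set 'rV[R]_d) A T :
  (forall i x, cvx (F i x)) -> cvx (cap F A T).
Proof.
by move=> cF p q l l01 Fp Fq i iA; apply: cF => //; [exact: Fp|exact: Fq].
Qed.

Lemma fat_slab d (K : set 'rV[R]_d.+1) V : fat K V ->
  exists p : R * R, [/\ p.1 < p.2, fat (sec K p.1) (V / (p.2 - p.1)) &
    fat (sec K p.2) (V / (p.2 - p.1))].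
Proof. by move=> [s [u h]]; exists (s, u). Qed.

(* Each [T] in [G] owns a slab of levels [lev T] crossed by its intersection.
   Let [b - a] be the length of the shortest interval containing the slabs of a
   fixed proportion of a dense core of [G]. Two slabs of adjacent elements of
   the core then typically span a length comparable to [b - a], and so do two
   consecutive slabs on the path of mixed tuples connecting them, which share
   all sets but one: the intersection of the common sets is fat above a whole
   cell of a grid of bounded size. *)
Lemma fat_cell d m (gamma : R) : (0 < m)%N -> 0 < gamma ->
  exists2 gamma' : R, 0 < gamma' &
  forall (X : finType) (F : 'I_m -> X -> set 'rV[R]_d.+1) (V : R)
    (A : {set 'I_m}) (G : pred {ffun 'I_m -> X}),
    (0 < #|X|)%N -> (forall i x, cvx (F i x)) -> 0 < V -> gamma <= dens G ->
    (forall T, G T -> fat (cap F A T) V) ->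
  exists a s u, s < u /\
    gamma' <= dens (fun T => G T && `[< forall x, s <= x <= u ->
      fat (sec (cap F (A :\ a)%SET T) x)
        (2^-1 ^+ d / (64 * m%:R) * (V / (u - s))) >]).
Proof.
move=> m0 gamma0.
have [g1 g10 blow] := @dens_blowup R bool 'I_m false gamma gamma0.
(* The [N] cells have width [delta / (64 * m)] and cover a window of length [2 * delta]. The core
   has degrees of density at least [g1 / 4], that is, twice [th]. *)
pose N := (128 * m)%N; pose th := g1 / 8.
have th0 : 0 < th by rewrite divr_gt0.
exists (th * th / (#|{: 'I_m * 'I_N}|)%:R).
  rewrite divr_gt0 ?mulr_gt0// ltr0n card_prod !card_ord /N.
  by rewrite !muln_gt0 m0.
move=> X F V A G X0 cF V0 gG GV.
have /choice[lev levP] : forall T, exists p : R * R, p.1 < p.2 /\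
    (G T -> fat (sec (cap F A T) p.1) (V / (p.2 - p.1)) /\
            fat (sec (cap F A T) p.2) (V / (p.2 - p.1))).
  move=> T; have [/GV/fat_slab[p [? ? ?]]|] := boolP (G T).
    by exists p.
  by move=> _; exists (0, 1).
pose l T := (lev T).1; pose u T := (lev T).2.
have lu T : l T < u T by have [] := levP T.
have qg := blow X G X0 gG; rewrite -dens_all_mix_split in qg.
have [D [D0 Ddeg]] := dense_core (@all_mix_sym _ _ G) (lt_le_trans g10 qg).
have {}Ddeg T : T \in D ->
    th + th <= dens (fun T' => (T' \in D) && all_mix G T T').
  by move=> /Ddeg; apply: le_trans; rewrite /th; lra.
have DG T : T \in D -> G T.
  move=> /Ddeg h.
  have /(@dens_gt0 R)[T' /andP[_ /forallP/(_ finset.set0)]] :=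
    lt_le_trans (addr_gt0 th0 th0) h.
  by rewrite (_ : mix _ _ _ = T)//; apply/ffunP => i; rewrite ffunE finset.inE.
have thD : th <= dens (fun T => T \in D).
  have /set0Pn[T TD] := D0; apply: (@le_trans _ _ (th + th)); first lra.
  by apply: (le_trans (Ddeg T TD)); apply: dens_le => ? /andP[].
have [a [b [thab ab_min]]] := short_interval l u th0 thD.
pose delta := b - a; pose rho := delta / (4 * m%:R).
have mR0 : 0 < m%:R :> R by rewrite ltr0n.
have d0 : 0 < delta.
  have /(@dens_gt0 R)[T /and3P[_ aT Tb]] := lt_le_trans th0 thab.
  by have := lu T; rewrite /delta; lra.
have rho0 : 0 < rho by rewrite divr_gt0// mulr_gt0.
have mrho : m%:R * rho = delta / 4 by rewrite /rho; field; rewrite gt_eqF.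
have rhod : rho <= delta / 4.
  by rewrite -mrho ler_peMl ?(ltW rho0)// ler1n.
pose w := rho / 16.
have w0 : 0 < w by rewrite divr_gt0.
have Nw : N%:R * w = 2 * delta.
  by rewrite /N natrM /w mulrAC -mulrA [rho * _]mulrC mulrA; nra.
pose cell (c : 'I_N) := a - delta / 2 + c%:R * w.
pose S (k : 'I_m) (c : 'I_N) T := G T && `[< forall x,
   cell c <= x <= cell c + w -> fat (sec (cap F (A :\ k)%SET T) x)
     (2^-1 ^+ d * (V / delta)) >].
pose P T := [&& T \in D, a <= l T & u T <= b].
pose Q T T' := all_mix G T T' && (delta / 4 <= hull (l T) (u T) (l T') (u T')).
have PQ : th * th <= dens (fun p => P p.1 && Q p.1 p.2).
  apply: dens_pairs; rewrite ?(ltW th0)// => T /and3P[TD aT Tb].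
  rewrite -(lerD2r th); apply: (le_trans (Ddeg T TD)).
  (* When the hull of the two slabs is short, that of [T'] lies in an interval of length less than
     [delta / 2]. By minimality of [delta] this concerns a proportion below [th]. *)
  pose Q' T' := [&& T' \in D, u T - delta / 4 <= l T' &
    u T' <= l T + delta / 4].
  apply: (@le_trans _ _ (dens (Q T) + dens Q')).
    apply: dens_union => T' /andP[T'D mTT']; rewrite /Q /Q' mTT' T'D/=.
    case: leP => //= h.
    have [[h1 h2 h3 h4] _] := hull_spec (l T) (u T) (l T') (u T').
    by apply/andP; split; lra.
  rewrite lerD2l leNgt; apply/negP => /ltW/ab_min.
  by have := lu T; rewrite -/delta; lra.
have PQ0 := lt_le_trans (mulr_gt0 th0 th0) PQ.
have [|[k c] /= kc] := @dens_pigeon R _ ('I_m * 'I_N)%type _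
  (fun c p => S c.1 c.2 (mix [set i : 'I_m | (i < c.1)%N]%SET p.1 p.2)) PQ0.
  move=> [T T'] /= /andP[/and3P[TD aT Tb] /andP[/forallP mTT' hTT']].
  pose M n := mix [set i : 'I_m | (i < n)%N]%SET T T'.
  have M0 : M 0 = T by apply/ffunP => i; rewrite ffunE finset.inE.
  have Mm : M m = T' by apply/ffunP => i; rewrite ffunE finset.inE ltn_ord.
  have [||||k [km hk lk uk luk]] := @first_long_step R (fun n => l (M n))
    (fun n => u (M n)) m delta rho _ rho0 mrho.
  - by move=> n; exact: ltW.
  - by rewrite M0 /delta; lra.
  - by rewrite M0 Mm.
  - by [].
  rewrite M0 in lk uk.
  (* [M k] and [M k.+1] differ only at the index [k], so [K] contains both of their
     intersections. *)
  pose K := cap F (A :\ Ordinal km)%SET (M k).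
  have subK n : (n == k) || (n == k.+1) -> cap F A (M n) `<=` K.
    move=> nk p Fp i; rewrite in_setD1 => /andP[ik iA].
    suff <- : M n i = M k i by exact: Fp.
    rewrite !ffunE !finset.inE; case/orP: nk => /eqP -> //.
    by rewrite ltnS leq_eqVlt -[_ == _ :> nat]/(i == Ordinal km) (negPf ik).
  have [fl fu] := (levP (M k)).2 (mTT' _).
  have [fl' fu'] := (levP (M k.+1)).2 (mTT' _).
  have cK : cvx K by exact: cvx_cap.
  have [|||||||||x0 [x01 x02 x0P]] := @fat_next_to R d K V (l (M k)) (u (M k))
      (l (M k.+1)) (u (M k.+1)) a delta rho cK V0 (lu _).
  - by apply: fat_le fl => // z; apply: subK; rewrite eqxx.
  - by apply: fat_le fu => // z; apply: subK; rewrite eqxx.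
  - have [z Kz] := fat_nonempty fl'; exists z.
    by move: Kz; apply: subK; rewrite eqxx orbT.
  - have [z Kz] := fat_nonempty fu'; exists z.
    by move: Kz; apply: subK; rewrite eqxx orbT.
  - by rewrite rho0.
  - by lra.
  - by rewrite /delta in uk *; lra.
  - exact: luk.
  - exact: hk.
  have [||c [c1 c2]] := @grid_cell R x0 (a - delta / 2) w N w0.
  - by lra.
  - by rewrite Nw /w; lra.
  exists (Ordinal km, c); rewrite /S /= mTT'/=; apply/asboolP => x /andP[cx xc].
  apply: x0P; rewrite /cell /w in cx xc c1 c2 *; apply/andP; split; lra.
exists k, (cell c), (cell c + w); split; first by rewrite ltrDl.
(* A mixture of two uniform tuples is uniform, so the density over pairs becomes a density over
   single tuples. *)
rewrite dens_mix// in kc.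
apply: (le_trans _ (le_trans kc _)).
  by rewrite ler_wpM2r ?invr_ge0.
apply: dens_le => T; rewrite /S => /andP[-> /asboolP h]; apply/asboolP => x hx.
have -> : 2^-1 ^+ d / (64 * m%:R) * (V / (cell c + w - cell c)) =
    2^-1 ^+ d * (V / delta); last exact: h.
rewrite addrAC subrr add0r.
have -> : w = delta / (64 * m%:R) by rewrite /w /rho; field; rewrite gt_eqF.
by field; rewrite !gt_eqF.
Qed.

End Descent.

(** * Selecting fat subfamilies *)

Section Selection.
Variable R : realType.
Local Notation dens := (dens R).

(** By induction on [d]: [fat_cell] deletes one index and gives fat sections at two levels [s] and
    [u]. The induction hypothesis is applied at [s], then at [u] to the surviving indices; in all at
    most [1 + 2 * (2 ^ d - 1)] indices are lost. [P] is the union of the two common sections; [fat]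
    does not ask for convexity. The order of quantifiers makes [c] independent of [gamma]. *)
Lemma fat_common d m : (0 < m)%N ->
  exists2 c : R, 0 < c & forall gamma : R, 0 < gamma ->
  exists2 gamma' : R, 0 < gamma' &
  forall (X : finType) (F : 'I_m -> X -> set 'rV[R]_d) (V : R)
    (A : {set 'I_m}) (G : pred {ffun 'I_m -> X}),
    (0 < #|X|)%N -> (forall i x, cvx (F i x)) -> 0 < V -> gamma <= dens G ->
    (forall T, G T -> fat (cap F A T) V) ->
  exists (A' : {set 'I_m}) (P : set 'rV[R]_d),
    [/\ (#|A| < #|A'| + 2 ^ d)%N, A' \subset A, fat P (c * V) &
      gamma' <= dens (fun T =>
        G T && `[< forall i, i \in A' -> P `<=` F i (T i) >])].
Proof.
move=> m0; elim: d => [|d [c c0 IH]].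
  exists 1 => // gamma g0; exists gamma => // X F V A G _ _ _ gG GV.
  exists A, setT; split=> //; first by rewrite addn1.
    have [T /GV[_ V1]] := dens_gt0 (lt_le_trans g0 gG).
    by split; [exists 0|rewrite mul1r].
  apply: (le_trans gG); apply: dens_le => T GT; rewrite GT.
  apply/asboolP => i iA p _; have [[z Fz] _] := GV T GT.
  by rewrite (_ : p = z); [exact: Fz|rewrite [p]thinmx0 [z]thinmx0].
pose c1 : R := 2^-1 ^+ d / (64 * m%:R).
have c10 : 0 < c1 by rewrite divr_gt0 ?exprn_gt0 ?mulr_gt0 ?ltr0n.
exists (c * c1); first exact: mulr_gt0.
move=> gamma /(fat_cell d m0)[g1 g10 cell].
have [g2 g20 IH2] := IH _ g10; have [g3 g30 IH3] := IH _ g20.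
exists g3 => // X F V A G X0 cF V0 gG GV.
have [a [s [u [su {}cell]]]] := cell X F V A G X0 cF V0 gG GV.
pose W := c1 * (V / (u - s)).
have W0 : 0 < W by rewrite mulr_gt0// divr_gt0// subr_gt0.
pose Fs x := fun i y => sec (F i y) x.
have cFs x i y : cvx (Fs x i y) by exact: cvx_sec.
pose G1 T := G T && `[< forall x, s <= x <= u ->
      fat (sec (cap F (A :\ a)%SET T) x) W >].
have G1s T : G1 T -> fat (cap (Fs s) (A :\ a)%SET T) W.
  by move=> /andP[_ /asboolP]; apply; rewrite lexx/= ltW.
have G1u T : G1 T -> fat (cap (Fs u) (A :\ a)%SET T) W.
  by move=> /andP[_ /asboolP]; apply; rewrite lexx/= ltW.
have [A1 [P1 [cA1 sA1 fP1 dG2]]] := IH2 X (Fs s) W _ G1 X0 (cFs s) W0 cell G1s.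
set G2 := fun T => _ in dG2.
have [|A2 [P2 [cA2 sA2 fP2 dG3]]] := IH3 X (Fs u) W A1 G2 X0 (cFs u) W0 dG2.
  move=> T /andP[/G1u + _]; apply: fat_le => // p Fp i iA1.
  by apply: Fp; exact: (fintype.subsetP sA1).
exists A2, ([set p | exists2 z, P1 z & p = pcons s z] `|`
  [set p | exists2 z, P2 z & p = pcons u z]); split.
- rewrite expnS; move: cA1 cA2 (cardsD1 a A).
  move: #|A2| #|A1| #|A| #|(A :\ a)%SET| (2 ^ d)%N (a \in A).
  by clear=> n2 n1 n n' y [] /=; lia.
- exact: fintype.subset_trans sA2 (fintype.subset_trans sA1 (subD1set _ _)).
- exists s, u; split=> //.
    apply: fat_le fP1 => [z P1z|]; first by left; exists z.
    by rewrite /W !mulrA.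
  apply: fat_le fP2 => [z P2z|]; first by right; exists z.
  by rewrite /W !mulrA.
- apply: (le_trans dG3); apply: dens_le => T.
  move=> /andP[/andP[/andP[-> _] /asboolP h1] /asboolP h2].
  apply/asboolP => i iA2 p [[z Pz ->]|[z Pz ->]]; last exact: h2 Pz.
  by apply: h1 Pz; exact: (fintype.subsetP sA2).
Qed.

(* Levels are treated successively, thinning out the classes at each of them. *)
Lemma fat_levels d q :
  (forall m, exists t (c : R), [/\ 0 < c, (m <= t)%N &
    forall (F : 'I_q -> 'I_t -> set 'rV[R]_d) (A : {set 'I_q}) (V : R),
    (forall i x, cvx (F i x)) -> (d < #|A|)%N -> 0 < V ->
    (forall T, fat (cap F A T) V) ->
    exists k (e : 'I_m -> 'I_t), injective e /\
      fat [set p | forall j, F k (e j) p] (c * V)]) ->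
  forall r m, exists t (c : R), [/\ 0 < c, (m <= t)%N &
    forall (F : 'I_q -> 'I_t -> set 'rV[R]_d.+1) (A : {set 'I_q}) (V : R)
      (x : nat -> R),
    (forall i x, cvx (F i x)) -> (d < #|A|)%N -> 0 < V ->
    (forall j T, (j < r)%N -> fat (sec (cap F A T) (x j)) V) ->
    exists (k : nat -> 'I_q) (e : 'I_q -> 'I_m -> 'I_t),
      (forall i, injective (e i)) /\
      forall j, (j < r)%N ->
        fat (sec [set p | forall i, F (k j) (e (k j) i) p] (x j)) (c * V)].
Proof.
move=> W; elim=> [|r IH] m.
  exists m, 1; split=> // F A V x _ dA _ _.
  have /card_gt0P[k _] : (0 < #|A|)%N by exact: leq_trans dA.
  by exists (fun=> k), (fun _ i => i); split=> // i x1 x2.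
have [t1 [c1 [c10 mt1 W1]]] := W m; have [t [c2 [c20 t1t W2]]] := IH t1.
exists t, (Num.min c1 c2); split; first by rewrite lt_min c10.
  exact: leq_trans t1t.
move=> F A V x cF dA V0 hF.
(* The first [r] levels leave [t1] members in each class, enough to treat the level [x r]. Further
   thinning only enlarges the intersections already found. *)
have [|k [e [e_inj ke]]] := W2 F A V x cF dA V0.
  by move=> j T jr; apply: hF; exact: ltnW.
have [||k0 [e0 [e0_inj fk0]]] := W1
  (fun i y => sec (F i (e i y)) (x r)) A V _ dA V0.
- by move=> i y; exact: cvx_sec.
- move=> T; have := hF r [ffun i => e i (T i)] (leqnn _).
  by apply: fat_le => // p Fp i iA; have := Fp i iA; rewrite ffunE.
pose e1 i : 'I_m -> 'I_t1 := if i == k0 then e0 else widen_ord mt1.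
exists (fun j => if j == r then k0 else k j), (fun i y => e i (e1 i y)); split.
  move=> i y y' /e_inj; rewrite /e1; case: (i == k0) => [/e0_inj//|E].
  by apply/val_inj; have /(congr1 val) := E.
move=> j; rewrite ltnS leq_eqVlt; case: eqVneq => [-> _|jr /= {}jr].
  apply: fat_le fk0 => [p Fp y|]; first by have := Fp y; rewrite /e1 eqxx.
  by rewrite ler_wpM2r ?(ltW V0)// ge_min lexx.
apply: fat_le (ke j jr) => [p Fp y|]; first exact: Fp.
by rewrite ler_wpM2r ?(ltW V0)// ge_min lexx orbT.
Qed.

(** From dimension [d] to [d.+1], [fat_cell] yields an interval above which many transversals,
    without one class [a], have fat sections, and [dens_blowup_inj] makes this true of all
    transversals of a smaller partite configuration. Each of [q.+1] levels then singles out a class;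
    two levels share theirs, and the chosen members of that class have a fat intersection. *)
Lemma fat_class d q : (0 < q)%N -> forall m,
  exists t (c : R), [/\ 0 < c, (m <= t)%N &
    forall (F : 'I_q -> 'I_t -> set 'rV[R]_d) (A : {set 'I_q}) (V : R),
    (forall i x, cvx (F i x)) -> (d < #|A|)%N -> 0 < V ->
    (forall T, fat (cap F A T) V) ->
    exists k (e : 'I_m -> 'I_t), injective e /\
      fat [set p | forall j, F k (e j) p] (c * V)].
Proof.
move=> q0; elim: d => [|d IH] m.
  (* One more than [m], so that the classes are inhabited even when [m = 0]. *)
  exists m.+1, 1; split=> // F A V cF /card_gt0P[k kA] V0 hF.
  exists k, (widen_ord (leqnSn m)); split.
    by move=> y y' /(congr1 val) E; apply/val_inj.
  have [_ V1] := hF [ffun=> ord0]; split; last by rewrite mul1r.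
  exists 0 => j; have [[z Fz] _] := hF [ffun=> widen_ord (leqnSn m) j].
  by have := Fz k kA; rewrite ffunE [z]thinmx0.
have [t1 [c1 [c10 mt1 levels]]] := fat_levels IH q.+1 m.+1.
have [g g0 cell] := fat_cell d q0 (@ltr01 R).
have t10 : (0 < t1)%N by exact: leq_trans mt1.
have [n0 blow] := @dens_blowup_inj R 'I_t1 'I_q (Ordinal t10) g g0.
pose c0 : R := 2^-1 ^+ d / (64 * q%:R).
have qR0 : 0 < q%:R :> R by rewrite ltr0n.
have c00 : 0 < c0 by rewrite divr_gt0 ?exprn_gt0 ?mulr_gt0.
exists (maxn n0 m.+1), (c1 * c0 / q%:R); split.
- exact: divr_gt0 (mulr_gt0 c10 c00) qR0.
- by rewrite (leq_trans (leqnSn m))// leq_maxr.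
move=> F A V cF dA V0 hF; set t := maxn n0 m.+1 in F cF hF *.
have t0 : (0 < #|'I_t|)%N by rewrite card_ord /t (leq_trans _ (leq_maxr _ _)).
have [||a [s [u [su]]]] := cell 'I_t F V A predT t0 cF V0.
- rewrite /dens (@eq_card _ predT {: {ffun 'I_q -> 'I_t}})// divff//.
  by rewrite card_ffun pnatr_eq0 expn_eq0 -leqn0 leqNgt t0.
- by move=> T _; exact: hF.
move=> /blow[|w w_inj hw]; first by rewrite card_ord leq_maxl.
pose V1 := c0 * (V / (u - s)).
have us0 : 0 < u - s by rewrite subr_gt0.
have V10 : 0 < V1 by exact: mulr_gt0 c00 (divr_gt0 V0 us0).
(* Evenly spaced levels: two distinct ones are at least [(u - s) / q%:R] apart, whence the factor
   [1 / q%:R] in the constant. *)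
pose x j := s + (u - s) * (j%:R / q%:R).
have [||||k [e [e_inj ke]]] :=
  levels (fun i y => F i (w (y, i))) (A :\ a)%SET V1 x.
- by move=> *; exact: cF.
- move: dA (cardsD1 a A).
  move: #|A| #|(A :\ a)%SET| (a \in A).
  by clear=> n1 n2 [] /=; lia.
- by [].
- move=> j T jq; have /= /asboolP/(_ (x j)) := hw T.
  have -> : s <= x j <= u.
    apply/andP; split.
      by rewrite /x lerDl mulr_ge0 ?divr_ge0 ?(ltW us0)// ltW.
    rewrite /x -lerBrDl -[leRHS]mulr1 ler_pM2l// ler_pdivrMr// mul1r.
    by rewrite ler_nat.
  move=> /(_ isT); apply: fat_le => // p Fp i iA.
  by have := Fp i iA; rewrite ffunE.
have [i [j [ij kij]]] : exists i j : 'I_q.+1, (i < j)%N /\ k i = k j.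
  have /injectivePn[i [j ij kij]] : ~~ injectiveb (fun i : 'I_q.+1 => k i).
    apply/negP => /injectiveP/leq_card.
    by rewrite !card_ord ltnn.
  have [lt_ij|lt_ji|/val_inj E] := ltngtP i j; last by rewrite E eqxx in ij.
    by exists i, j.
  by exists j, i.
pose e' (y : 'I_m) := w (e (k i) (widen_ord (leqnSn m) y), k i).
exists (k i), e'; split.
  move=> y y' /w_inj[/e_inj/(congr1 val)] E; exact/val_inj.
have xij : x j - x i = (u - s) * ((j%:R - i%:R) / q%:R).
  by rewrite /x; ring.
have ji1 : 1 <= j%:R - i%:R :> R.
  by rewrite lerBrDl -(natrD R _ 1) ler_nat addn1.
have xij0 : 0 < x j - x i.
  by rewrite xij mulr_gt0// divr_gt0//; lra.
have cV : c1 * c0 / q%:R * V / (x j - x i) <= c1 * V1.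
  rewrite ler_pdivrMr// xij /V1.
  have -> : c1 * (c0 * (V / (u - s))) * ((u - s) * ((j%:R - i%:R) / q%:R)) =
    c1 * c0 / q%:R * V * (j%:R - i%:R) by field; rewrite !gt_eqF.
  by rewrite ler_peMr// mulr_ge0 ?divr_ge0 ?mulr_ge0// ltW.
exists (x i), (x j); split; first by rewrite -subr_gt0.
  apply: fat_le (ke i _) => // p Fp y; exact: Fp.
apply: fat_le (ke j _) => // p; rewrite -kij => Fp y; exact: Fp.
Qed.

End Selection.

(** * Volume of fat sets *)

Section CoverLowerBound.
Variable R : realType.

(** Tonelli for a countable cover: [[a k, b k]] is the extent of the box [k] along the first axis
    and [v k] the volume of its base; the lower bound at each level is integrated over [[s, u]]. *)
Lemma integral_interval_cover (s u c : R) (a b v : nat -> R) :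
  s < u -> 0 <= c -> (forall k, 0 <= v k) -> (forall k, a k <= b k) ->
  (forall x, s <= x <= u ->
    (c%:E <= \sum_(0 <= k <oo) (v k * (a k <= x <= b k)%R%:R)%:E)%E) ->
  (((u - s) * c)%:E <= \sum_(0 <= k <oo) ((b k - a k) * v k)%:E)%E.
Proof.
move=> su c0 v0 ab h; pose mu := @lebesgue_measure R.
have leb x y : x <= y -> mu `[x, y]%classic = (y - x)%:E.
  rewrite /mu lebesgue_measure_itv/= lte_fin le_eqVlt.
  by case: ltgtP => [|//|->]//= _; rewrite subrr.
pose D : set (measurableTypeR R) := `[s, u]%classic.
have mD : measurable D by exact: measurable_itv.
pose I k : set (measurableTypeR R) := `[a k, b k]%classic.
have mI k : measurable (I k) by exact: measurable_itv.
pose f k (x : measurableTypeR R) := ((v k)%:E * (\1_(I k) x)%:E)%E.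
have fE k x : f k x = (v k * (a k <= x <= b k)%R%:R)%:E.
  rewrite /f -EFinM indicE.
  suff -> : (x \in I k) = (a k <= x <= b k)%R by [].
  apply/idP/idP => [|h']; first by rewrite inE /I/= in_itv.
  by rewrite inE /I/= in_itv.
have f0 k x : (0 <= f k x)%E by rewrite fE lee_fin mulr_ge0.
have mf k : measurable_fun D (f k).
  by apply: measurable_funeM; exact/measurable_EFinP/measurable_indic.
have -> : ((u - s) * c)%:E = (\int[mu]_(x in D) cst c%:E x)%E.
  rewrite integral_cst// mulrC EFinM; congr (_ * _)%E.
  by rewrite -leb// ltW.
apply: (@le_trans _ _ (\int[mu]_(x in D) (\sum_(0 <= k <oo) f k x))%E).
  apply: ge0_le_integral => //.
  - have := @ge0_emeasurable_sum _ _ _ D f xpredT.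
    rewrite (_ : (fun x => (\sum_(i <oo | i \in xpredT) f i x)%E) =
                 (fun x => (\sum_(0 <= k <oo) f k x)%E)); first by apply.
    by apply/funext => x; exact: eq_eseriesl.
  move=> x; rewrite /D/= in_itv/= => /h/le_trans; apply.
  by under eq_eseriesr do rewrite -fE.
rewrite integral_nneseries//; apply: lee_nneseries => [k _ _|k _].
  exact: integral_ge0.
rewrite ge0_integralZl_EFin//.
  rewrite integral_indic// mulrC EFinM lee_wpmul2l ?lee_fin//.
  apply: (@le_trans _ _ (mu (I k))).
    by apply: le_measure; rewrite ?inE//; exact: measurableI.
  by rewrite leb.
exact/measurable_EFinP/measurable_indic.
Qed.

(* A box is given by its two extreme corners; [None] stands for the empty box,
   which is not a box in dimension [0]. *)
Definition obox := fun d => option ('rV[R]_d * 'rV[R]_d).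

Definition obox_set d (B : obox d) : set 'rV[R]_d :=
  if B is Some ab then box ab.1 ab.2 else set0.

Definition obox_vol d (B : obox d) : R :=
  if B is Some ab then box_vol ab.1 ab.2 else 0.

Definition obox_wf d (B : obox d) :=
  if B is Some ab then forall i, ab.1 ord0 i <= ab.2 ord0 i else True.

Lemma obox_vol_ge0 d (B : obox d) : obox_wf B -> 0 <= obox_vol B.
Proof.
case: B => //= -[a b]/= ab; apply: prodr_ge0 => i _.
by rewrite subr_ge0.
Qed.

Lemma box_vol_pcons d (a b : 'rV[R]_d.+1) : box_vol a b =
  (b ord0 ord0 - a ord0 ord0) * box_vol (ptail a) (ptail b).
Proof.
rewrite /box_vol big_ord_recl; congr (_ * _).
by apply: eq_bigr => i _; rewrite !mxE.
Qed.

Lemma box_pcons d (a b : 'rV[R]_d.+1) x z : box a b (pcons x z) <->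
  a ord0 ord0 <= x <= b ord0 ord0 /\ box (ptail a) (ptail b) z.
Proof.
split=> [h|[h0 h] i].
  split; first by have := h ord0; rewrite pcons_head.
  by move=> i; have := h (lift ord0 i); rewrite pcons_lift !mxE.
case: (unliftP ord0 i) => [j ->|->]; last by rewrite pcons_head.
by have := h j; rewrite pcons_lift !mxE.
Qed.

(** All sections between the two fat ones are fat up to [2 ^ d], by [fat_between]. A cover of [K]
    cuts out a cover of each of them, to which the induction hypothesis applies, and the bounds are
    integrated. *)
Lemma fat_cover_ge d : exists2 c : R, 0 < c &
  forall (K : set 'rV[R]_d) V (B : nat -> obox d), cvx K -> 0 <= V ->
    fat K V -> (forall k, obox_wf (B k)) ->
    K `<=` \bigcup_k obox_set (B k) ->
    ((c * V)%:E <= \sum_(0 <= k <oo) (obox_vol (B k))%:E)%E.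
Proof.
elim: d => [|d [c c0 IH]].
  exists 1 => // K V B _ V0 [[z Kz] V1] Bwf KB.
  have [k _ Bz] := KB z Kz.
  have B0 n : (0 <= (obox_vol (B n))%:E)%E by rewrite lee_fin obox_vol_ge0.
  apply: le_trans (nneseries_lim_ge k.+1 (fun n _ _ => B0 n)).
  rewrite big_nat_recr//= -[leLHS]add0e leeD//; first exact: sume_ge0.
  move: Bz; case: (B k) => //= ab _.
  by rewrite /box_vol big_ord0 lee_fin mul1r.
exists (c * 2^-1 ^+ d); first by rewrite mulr_gt0// exprn_gt0.
move=> K V B cK V0 [s [u [su fs fu]]] Bwf KB.
pose W := V / (u - s).
have W0 : 0 <= W by rewrite divr_ge0// subr_ge0 ltW.
have fx x : s <= x <= u -> fat (sec K x) (2^-1 ^+ d * W).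
  move=> /andP[sx xu]; have [h|h] := leP (2 * x) (s + u).
    by apply: (fat_between (y := u)) fs => //; [exact: fat_nonempty fu|left].
  apply: (fat_between (y := s)) fu => //; first exact: fat_nonempty fs.
  by right; split=> //; rewrite addrC ltW.
pose a k := if B k is Some ab then ab.1 ord0 ord0 else 0.
pose b k := if B k is Some ab then ab.2 ord0 ord0 else 0.
pose v k := if B k is Some ab then box_vol (ptail ab.1) (ptail ab.2) else 0.
have -> : c * 2^-1 ^+ d * V = (u - s) * (c * (2^-1 ^+ d * W)).
  by rewrite /W; field; rewrite subr_eq0 gt_eqF.
have -> : (\sum_(0 <= k <oo) (obox_vol (B k))%:E)%E =
    (\sum_(0 <= k <oo) ((b k - a k) * v k)%:E)%E.
  apply: eq_eseriesr => k _; rewrite /a /b /v; case: (B k) => [ab|] /=.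
    by rewrite box_vol_pcons.
  by rewrite mulr0.
apply: integral_interval_cover => //.
- by rewrite mulr_ge0 ?(ltW c0)// mulr_ge0 ?exprn_ge0.
- move=> k; rewrite /v; have := Bwf k; case: (B k) => [ab|] //= h.
  by apply: prodr_ge0 => i _; rewrite !mxE subr_ge0.
- by move=> k; rewrite /a /b; have := Bwf k; case: (B k) => [ab|].
move=> x sxu.
(* Boxes missing the level [x] become [None]: in dimension 0 every genuine box has volume 1 and
   would be counted. *)
pose Bx k : obox d := if B k is Some ab then
   if ab.1 ord0 ord0 <= x <= ab.2 ord0 ord0
   then Some (ptail ab.1, ptail ab.2) else None else None.
have -> : (\sum_(0 <= k <oo) (v k * (a k <= x <= b k)%R%:R)%:E)%E =
    (\sum_(0 <= k <oo) (obox_vol (Bx k))%:E)%E.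
  apply: eq_eseriesr => k _; rewrite /a /b /v /Bx; case: (B k) => [ab|] /=.
    by case: ifP => _; rewrite ?mulr1 ?mulr0.
  by rewrite mul0r.
apply: (IH (sec K x)).
- exact: cvx_sec.
- by rewrite mulr_ge0 ?exprn_ge0.
- exact: fx.
- move=> k; rewrite /Bx; have := Bwf k; case: (B k) => [ab|] //= h.
  by case: ifP => //= _ i; rewrite !mxE.
move=> z /KB[k _ Bz]; exists k => //; move: Bz; rewrite /Bx.
by case: (B k) => [ab|] //= /box_pcons[-> ].
Qed.

Lemma vol_fat_ge d : exists2 c : R, 0 < c &
  forall (K : set 'rV[R]_d) V, cvx K -> 0 <= V -> fat K V ->
    ((c * V)%:E <= vol K)%E.
Proof.
have [c c0 h] := fat_cover_ge d; exists c => // K V cK V0 fK.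
apply: le_ereal_inf_tmp => _ [ab [abwf Kab] <-].
exact: (h K V (fun k => Some (ab k)) cK V0 fK abwf).
Qed.

End CoverLowerBound.

(** * Covering thin convex sets by boxes *)

Section CoverUpperBound.
Variable R : realType.

(** Bounded partial sums replace the extended real series, so that all estimates take place in
    [R]. *)
Definition covers d (A : set 'rV[R]_d) (v : R) :=
  exists B : nat -> obox R d, [/\ forall k, obox_wf (B k),
    A `<=` \bigcup_k obox_set (B k) &
    forall n, \sum_(k < n) obox_vol (B k) <= v].

Lemma covers_le d (A A' : set 'rV[R]_d) v v' :
  A' `<=` A -> v <= v' -> covers A v -> covers A' v'.
Proof.
move=> A'A vv' [B [Bwf AB Bv]]; exists B; split=> // [z /A'A/AB//|n].
exact: le_trans vv'.
Qed.

Lemma covers_set0 d v : 0 <= v -> covers (@set0 'rV[R]_d) v.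
Proof.
by move=> v0; exists (fun=> None); split=> // n; rewrite big1.
Qed.

Lemma sum_uniq_le (T : eqType) (s s' : seq T) (F : T -> R) :
  uniq s -> uniq s' -> {subset s <= s'} -> (forall t, 0 <= F t) ->
  \sum_(t <- s) F t <= \sum_(t <- s') F t.
Proof.
move=> us us' ss' F0; rewrite [leRHS](bigID (mem s))/=.
rewrite -[X in _ <= X + _]big_filter -[leLHS]addr0 lerD ?sumr_ge0//.
rewrite (perm_big [seq t <- s' | t \in s])//.
apply: uniq_perm => //; first exact: filter_uniq.
move=> t; rewrite mem_filter; apply/idP/andP => [ts|[]//].
by split=> //; exact: ss'.
Qed.

(** The double family of boxes is enumerated through [pickle_inv]; finitely many of its terms fit in
    a square [M] by [M], summed row by row. *)
Lemma covers_bigcup d (A : nat -> set 'rV[R]_d) (v : nat -> R) w :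
  (forall j, covers (A j) (v j)) -> (forall n, \sum_(j < n) v j <= w) ->
  covers (\bigcup_j A j) w.
Proof.
move=> /choice[B hB] vw.
pose G (o : option (nat * nat)) := if o is Some jk then B jk.1 jk.2 else None.
have Gwf o : obox_wf (G o).
  by case: o => //= -[j k]; have [+ _ _] := hB j; apply.
exists (fun n => G (pickle_inv n)); split=> [k|z [j _ Az]|N] //.
  have [_ + _] := hB j => /(_ z Az)[k _ Bz].
  by exists (pickle (j, k)) => //; rewrite pickleK_inv.
pose s := pmap (@pickle_inv (nat * nat)%type) (iota 0 N).
have us : uniq s.
  apply: pmap_uniq (iota_uniq _ _) => n; exact: pickle_invK.
have -> : \sum_(n < N) obox_vol (G (pickle_inv n)) =
    \sum_(jk <- s) obox_vol (B jk.1 jk.2).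
  rewrite -(big_mkord xpredT (fun n => obox_vol (G (pickle_inv n)))).
  rewrite /index_iota subn0 /s.
  by elim: (iota 0 N) => [|n r IH]; rewrite ?big_nil//= big_cons IH;
    case: pickle_inv => [jk|]; rewrite /= ?big_cons ?add0r.
have [M sM'] : exists M, forall jk, jk \in s -> (maxn jk.1 jk.2 < M)%N.
  exists (\max_(jk <- s) maxn jk.1 jk.2).+1 => jk jks; rewrite ltnS.
  exact: (@leq_bigmax_seq _ s xpredT (fun jk => maxn jk.1 jk.2) jk).
have sM : {subset s <= [seq (j, k) | j <- iota 0 M, k <- iota 0 M]}.
  move=> [j k] /sM'; rewrite gtn_max => /andP[jM kM]; apply/allpairsP.
  by exists (j, k); rewrite !mem_iota.
apply: le_trans (sum_uniq_le us _ sM _) _.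
- by apply: allpairs_uniq; rewrite ?iota_uniq// => -[? ?] [? ?].
- by move=> [j k] /=; apply: obox_vol_ge0; have [+ _ _] := hB j; apply.
rewrite big_allpairs; apply: le_trans (vw M).
rewrite -(big_mkord xpredT) /index_iota subn0; apply: ler_sum => j _.
have [_ _ /(_ M)] := hB j.
by rewrite -(big_mkord xpredT (fun k => obox_vol (B j k))) /index_iota subn0.
Qed.

End CoverUpperBound.

(** * Covering cones over sections *)

Section TiltedPrisms.
Variable R : realType.

Lemma prod_perturb d (p : 'I_d -> R) eps : (forall i, 0 <= p i) -> 0 < eps ->
  exists2 eta, 0 < eta & forall t, 0 <= t <= eta ->
    \prod_i (p i + t) <= \prod_i p i + eps.
Proof.
elim: d p eps => [|d IH] p eps p0 e0.
  by exists 1 => // t _; rewrite !big_ord0 lerDl ltW.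
have p00 := p0 ord0; set q := p ord0 in p00.
pose P := \prod_i p (lift ord0 i).
have P0 : 0 <= P by exact: prodr_ge0.
have e1 : 0 < eps / (2 * (q + 1)) by rewrite divr_gt0// mulr_gt0//; lra.
have [eta eta0 h] := IH (fun i => p (lift ord0 i)) _ (fun i => p0 _) e1.
exists (Num.min eta (Num.min 1 (eps / (2 * (P + 1))))).
  rewrite !lt_min eta0 ltr01 divr_gt0// mulr_gt0//; lra.
move=> t; rewrite !le_min => /and4P[t0 teta t1 tP].
rewrite !big_ord_recl -/q -/P.
have {}h := h t; rewrite t0 teta -/P in h; have {}h := h isT.
apply: (@le_trans _ _ ((q + t) * (P + eps / (2 * (q + 1))))).
  by rewrite ler_wpM2l// addr_ge0.
have : t * P <= eps / 2.
  move: tP; rewrite ler_pdivlMr; last by lra.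
  nra.
have : (q + t) * (eps / (2 * (q + 1))) <= eps / 2.
  have -> : eps / 2 = (q + 1) * (eps / (2 * (q + 1))).
    by field; rewrite gt_eqF//; lra.
  by rewrite ler_wpM2r ?(ltW e1)// lerD2l.
rewrite !mulrDr !mulrDl; lra.
Qed.

Lemma grid_slot (h t : R) N : 0 <= t <= N%:R * h -> (0 < N)%N ->
  exists2 k, (k < N)%N & k%:R * h <= t <= k.+1%:R * h.
Proof.
elim: N => // -[|N] IH /andP[t0 tN] _.
  by exists 0; rewrite // mul0r t0.
have [tN'|tN'] := leP t (N.+1%:R * h).
  have [|//|k kN hk] := IH _ _; first by rewrite t0.
  by exists k => //; exact: ltnW.
by exists N.+1 => //; rewrite (ltW tN') tN.
Qed.

Lemma sum_initial_le (c : R) n N : 0 <= c ->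
  \sum_(k < n) (if (k < N)%N then c else 0) <= N%:R * c.
Proof.
move=> c0; suff -> : \sum_(k < n) (if (k < N)%N then c else 0) =
    (minn n N)%:R * c by rewrite ler_wpM2r// ler_nat geq_minr.
elim: n => [|n IH]; first by rewrite big_ord0 min0n mul0r.
rewrite big_ord_recr/= IH; case: ltnP => nN.
  by rewrite (minn_idPl nN) -natr1 mulrDl mul1r.
by rewrite addr0 (minn_idPr (leqW nN)).
Qed.

Lemma sum_geometric_half n :
  \sum_(k < n) (2^-1 : R) ^+ k.+1 = 1 - 2^-1 ^+ n.
Proof.
elim: n => [|n IH]; first by rewrite big_ord0 expr0 subrr.
by rewrite big_ord_recr/= IH !exprS; lra.
Qed.

Lemma ptail_pcons d x (z : 'rV[R]_d) : ptail (pcons x z) = z.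
Proof. by apply/rowP => i; rewrite mxE pcons_lift. Qed.

(** A generalised truncated cone: its section at level [y] is the image of [A] under the homothety
    of centre [e] and ratio [mu y]. *)
Definition tilt d (e : 'rV[R]_d) (mu : R -> R) (alpha beta : R)
    (A : set 'rV[R]_d) : set 'rV[R]_d.+1 :=
  [set q | exists y z, [/\ alpha <= y <= beta, A z &
    q = pcons y (e + mu y *: (z - e))]].

(** Cut into [N] slices of height [h]. Within a slice the ratio varies by at most [kappa * h], so
    the slice fits in the homothetic box at its bottom level, enlarged by [t / 2 = kappa * E * h] on
    each side, [E] bounding the coordinates relative to [e]. *)
Lemma covers_tilt_box d (e a b : 'rV[R]_d) (mu : R -> R)
    (kappa M alpha beta eps : R) :
  alpha <= beta -> 0 <= kappa ->
  (forall y, alpha <= y <= beta -> 0 <= mu y <= M) ->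
  (forall y y', `|mu y - mu y'| <= kappa * `|y - y'|) ->
  (forall i, a ord0 i <= b ord0 i) -> 0 < eps ->
  covers (tilt e mu alpha beta (box a b))
    ((beta - alpha) * (M ^+ d * box_vol a b) + eps).
Proof.
move=> ab k0 mu01 mu_lip wf eps0.
pose E := 1 + \sum_i (`|a ord0 i - e ord0 i| + `|b ord0 i - e ord0 i|).
have E0 : 0 < E by rewrite ltr_pwDl// sumr_ge0// => i _; rewrite addr_ge0.
have zE z i : box a b z -> `|z ord0 i - e ord0 i| <= E.
  move=> /(_ i)/andP[az zb].
  apply: (@le_trans _ _ (`|a ord0 i - e ord0 i| + `|b ord0 i - e ord0 i|)).
    have := ler_norm (b ord0 i - e ord0 i).
    have := ler_norm (- (a ord0 i - e ord0 i)); rewrite normrN.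
    have := normr_ge0 (a ord0 i - e ord0 i).
    have := normr_ge0 (b ord0 i - e ord0 i).
    by rewrite ler_norml => *; apply/andP; split; lra.
  by rewrite /E (bigD1 i)//= addrCA lerDl addr_ge0// sumr_ge0.
have M0 : 0 <= M.
  have /andP[] : 0 <= mu alpha <= M by apply: mu01; rewrite lexx.
  exact: le_trans.
pose D := beta - alpha; have D0 : 0 <= D by rewrite subr_ge0.
pose p i := M * (b ord0 i - a ord0 i).
have p0 i : 0 <= p i by rewrite mulr_ge0// subr_ge0.
pose eps' := eps / (D + 1).
have eps'0 : 0 < eps' by rewrite divr_gt0// ltr_wpDl.
have [eta eta0 heta] := prod_perturb p0 eps'0.
(* Slices so thin that the enlargement is at most [eta], which costs at most [eps'] in the volume of
   each base. *)
pose N := (Num.truncn (2 * kappa * E * D / eta)).+1.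
pose h := D / N%:R; have NR0 : 0 < N%:R :> R by rewrite ltr0n.
have Nh : N%:R * h = D by rewrite /h mulrC divfK// gt_eqF.
have h0 : 0 <= h by rewrite divr_ge0// ltW.
have heps : 2 * kappa * E * h <= eta.
  rewrite /h mulrA ler_pdivrMr// [eta * _]mulrC -ler_pdivrMr//.
  by rewrite ltW// truncnS_gt.
pose t := 2 * kappa * E * h.
have t0 : 0 <= t by rewrite !mulr_ge0// ltW.
pose m k := mu (alpha + k%:R * h).
have hm k : (k < N)%N -> 0 <= m k <= M.
  move=> kN; apply: mu01; rewrite lerDl mulr_ge0//= -lerBrDl -/D -Nh.
  by rewrite ler_wpM2r// ler_nat ltnW.
pose lo k : 'rV[R]_d.+1 := pcons (alpha + k%:R * h)
  (\row_i (e ord0 i + m k * (a ord0 i - e ord0 i) - t / 2)).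
pose hi k : 'rV[R]_d.+1 := pcons (alpha + k.+1%:R * h)
  (\row_i (e ord0 i + m k * (b ord0 i - e ord0 i) + t / 2)).
pose B k : obox R d.+1 := if (k < N)%N then Some (lo k, hi k) else None.
have side k i : (k < N)%N -> 0 <= (ptail (hi k)) ord0 i - (ptail (lo k)) ord0 i
    <= p i + t.
  move=> /hm/andP[m0 mM]; rewrite !ptail_pcons !mxE.
  have -> : e ord0 i + m k * (b ord0 i - e ord0 i) + t / 2 -
    (e ord0 i + m k * (a ord0 i - e ord0 i) - t / 2) =
    m k * (b ord0 i - a ord0 i) + t by field.
  apply/andP; split; first by rewrite addr_ge0// mulr_ge0// subr_ge0.
  by rewrite lerD2r /p ler_wpM2r// subr_ge0.
exists B; split=> [k||n].
- rewrite /B; case: ltnP => //= kN i; case: (unliftP ord0 i) => [j ->|->].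
    have /andP[] := side k j kN.
    by rewrite subr_ge0 !mxE.
  by rewrite /lo /hi !pcons_head lerD2l ler_wpM2r// ler_nat.
- move=> _ [y [z [/andP[ay yb] Az ->]]].
  have [||k kN /andP[ky yk]] := @grid_slot h (y - alpha) N.
  + by rewrite Nh subr_ge0 ay lerD2r.
  + by [].
  exists k => //; rewrite /B kN /=; apply/box_pcons.
  rewrite /lo /hi !pcons_head !ptail_pcons; split; first by lra.
  move=> i; rewrite !mxE.
  have dm : `|mu y - m k| * `|z ord0 i - e ord0 i| <= t / 2.
    apply: (@le_trans _ _ ((kappa * h) * E)); last by rewrite /t; lra.
    apply: ler_pM => //; last exact: zE.
    apply: le_trans (mu_lip _ _) _; rewrite ler_wpM2l// ger0_norm; last by lra.
    by move: yk; rewrite -natr1 mulrDl mul1r; lra.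
  rewrite -normrM ler_norml in dm; case/andP: dm => d1 d2.
  have /andP[m0 _] := hm k kN; have /andP[az zb] := Az i.
  have z1 : m k * (a ord0 i - e ord0 i) <= m k * (z ord0 i - e ord0 i).
    by rewrite ler_wpM2l// lerD2r.
  have z2 : m k * (z ord0 i - e ord0 i) <= m k * (b ord0 i - e ord0 i).
    by rewrite ler_wpM2l// lerD2r.
  by rewrite mulrBl in d1 d2; apply/andP; split; lra.
pose c := h * (\prod_i p i + eps').
have c0 : 0 <= c by rewrite mulr_ge0// addr_ge0 ?prodr_ge0// ltW.
apply: (@le_trans _ _ (N%:R * c)).
  apply: le_trans (sum_initial_le n N c0); apply: ler_sum => k _.
  rewrite /B; case: ltnP => //= kN; rewrite box_vol_pcons.
  have -> : hi k ord0 ord0 - lo k ord0 ord0 = h.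
    by rewrite !pcons_head -natr1; ring.
  rewrite ler_wpM2l//; apply: le_trans (heta t _); last by rewrite t0.
  by apply: ler_prod => i _; exact: side.
rewrite /c mulrA Nh mulrDr lerD//.
  by rewrite ler_wpM2l// /p big_split/= prodr_const card_ord.
rewrite /eps' mulrA ler_pdivrMr ?ltr_wpDl// mulrC.
by rewrite ler_wpM2l ?(ltW eps0)// lerDl.
Qed.

Lemma covers_tilt d (e : 'rV[R]_d) A (mu : R -> R)
    (kappa M alpha beta v eps : R) :
  alpha <= beta -> 0 <= kappa ->
  (forall y, alpha <= y <= beta -> 0 <= mu y <= M) ->
  (forall y y', `|mu y - mu y'| <= kappa * `|y - y'|) ->
  covers A v -> 0 < eps ->
  covers (tilt e mu alpha beta A) ((beta - alpha) * (M ^+ d * v) + eps).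
Proof.
move=> ab k0 mu01 mu_lip [B [Bwf AB Bv]] eps0.
have M0 : 0 <= M.
  have /andP[] : 0 <= mu alpha <= M by apply: mu01; rewrite lexx.
  exact: le_trans.
apply: (@covers_le _ _ (\bigcup_k tilt e mu alpha beta (obox_set (B k)))
    _ _ _ _ (lexx _)).
  by move=> q [y [z [hy /AB[k _ Bz] ->]]]; exists k => //; exists y, z.
apply: (@covers_bigcup _ _ _ (fun k => (beta - alpha) *
    (M ^+ d * obox_vol (B k)) + eps * 2^-1 ^+ k.+1)).
  move=> k; have ek : 0 < eps * 2^-1 ^+ k.+1.
    by rewrite mulr_gt0// exprn_gt0.
  have := Bwf k; case: (B k) => [[a b] wf|_] /=.
    exact: covers_tilt_box ab k0 mu01 mu_lip wf ek.
  apply: (@covers_le _ _ set0 _ _ _ _ (lexx _)) => [q [y [z []//]]|].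
  by apply: covers_set0; rewrite !mulr0 add0r ltW.
move=> n; rewrite big_split/= -mulr_sumr -mulr_sumr -mulr_sumr lerD//.
  by rewrite ler_wpM2l ?subr_ge0// ler_wpM2l ?exprn_ge0// Bv.
by rewrite sum_geometric_half ler_piMr ?(ltW eps0)// gerBl exprn_ge0.
Qed.

(* Seen from a point of the section [K_y0], the part of a convex set [K] beyond
   the section [K_x] lies in the cone over [K_x]. *)
Lemma covers_cone d (K : set 'rV[R]_d.+1) (x y0 M alpha beta v eps : R) :
  cvx K -> sec K y0 !=set0 -> x != y0 -> alpha <= beta ->
  (forall y, alpha <= y <= beta -> 1 <= (y - y0) / (x - y0) <= M) ->
  covers (sec K x) v -> 0 < eps ->
  covers (K `&` [set q | alpha <= q ord0 ord0 <= beta])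
    ((beta - alpha) * (M ^+ d * v) + eps).
Proof.
move=> cK [e Ke] xy ab hM Kv eps0; rewrite -subr_eq0 in xy.
pose mu y := (y - y0) / (x - y0).
have mu01 y : alpha <= y <= beta -> 0 <= mu y <= M.
  by move=> /hM/andP[h1 ->]; rewrite andbT (le_trans ler01).
have mu_lip y y' : `|mu y - mu y'| <= `|x - y0|^-1 * `|y - y'|.
  by rewrite /mu -mulrBl normrM normfV mulrC opprB addrA subrK.
have k0 : 0 <= `|x - y0|^-1 by rewrite invr_ge0.
apply: covers_le (covers_tilt e ab k0 mu01 mu_lip Kv eps0) => //.
move=> q [Kq hq]; set y := q ord0 ord0 in hq; set w := ptail q.
have /andP[m1 _] := hM y hq; rewrite -/(mu y) in m1.
have m0 : mu y != 0 by rewrite gt_eqF// (lt_le_trans ltr01).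
exists y, (e + (mu y)^-1 *: (w - e)); split=> //; last first.
  rewrite [e + _ - e]addrAC subrr add0r scalerA divff// scale1r addrC subrK.
  by rewrite pconsK.
rewrite /sec/=.
have -> : x = (1 - (mu y)^-1) * y0 + (mu y)^-1 * y.
  have y0y : y - y0 != 0 by apply: contra m0 => /eqP E; rewrite /mu E mul0r.
  by rewrite /mu; field; rewrite y0y xy.
have -> : e + (mu y)^-1 *: (w - e) = (1 - (mu y)^-1) *: e + (mu y)^-1 *: w.
  by rewrite scalerBr scalerBl scale1r [_ *: w - _]addrC addrA.
rewrite pcons_affine; apply: cK => //; last by rewrite pconsK.
by rewrite invr_ge0 (le_trans ler01 m1)/= invf_le1// (lt_le_trans ltr01).
Qed.

(** Otherwise the levels halfway from [x] to [y1] and to [y2], which are [(y2 - y1) / 2] apart,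
    would have fat sections by [fat_between], and [K] would be fat. *)
Lemma not_fat_sec d (K : set 'rV[R]_d.+1) (V y1 x y2 : R) : cvx K -> 0 < V ->
  ~ fat K V -> y1 < x < y2 -> sec K y1 !=set0 -> sec K y2 !=set0 ->
  ~ fat (sec K x) (2 ^+ d.+1 * V / (y2 - y1)).
Proof.
move=> cK V0 nf /andP[y1x xy2] K1 K2 fx; apply: nf.
have y21 : 0 < y2 - y1 by lra.
have W0 : 0 <= 2 ^+ d.+1 * V / (y2 - y1).
  by rewrite !mulr_ge0 ?exprn_ge0 ?invr_ge0 ?(ltW V0) ?(ltW y21).
exists ((y1 + x) / 2), ((x + y2) / 2); split; first by lra.
  have -> : V / ((x + y2) / 2 - (y1 + x) / 2) =
      2^-1 ^+ d * (2 ^+ d.+1 * V / (y2 - y1)).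
    rewrite exprS exprVn; field.
    by rewrite expf_neq0 ?gt_eqF//=; lra.
  apply: (fat_between (y := y1)) fx => //; right; lra.
have -> : V / ((x + y2) / 2 - (y1 + x) / 2) =
    2^-1 ^+ d * (2 ^+ d.+1 * V / (y2 - y1)).
  rewrite exprS exprVn; field.
  by rewrite expf_neq0 ?gt_eqF//=; lra.
by apply: (fat_between (y := y2)) fx => //; left; lra.
Qed.

End TiltedPrisms.

(** * Convex sets that are not fat have small volume *)

Section FatOfVolume.
Variable R : realType.

Lemma covers_ge0 d (A : set 'rV[R]_d) v : covers A v -> 0 <= v.
Proof. by move=> [B [_ _ /(_ 0)]]; rewrite big_ord0. Qed.

Lemma covers_setU d (A A' : set 'rV[R]_d) v v' :
  covers A v -> covers A' v' -> covers (A `|` A') (v + v').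
Proof.
move=> Av Av'; have v0 := covers_ge0 Av; have v'0 := covers_ge0 Av'.
pose F j := if j is 0 then A else if j is 1 then A' else set0.
pose w j := if j is 0 then v else if j is 1 then v' else 0.
apply: (@covers_le _ _ (\bigcup_j F j) _ _ _ _ (lexx _)).
  by move=> q [Aq|Aq]; [exists 0|exists 1].
apply: (@covers_bigcup _ _ _ w) => [[|[|j]]|[|[|n]]] //.
- exact: covers_set0.
- by rewrite big_ord0 addr_ge0.
- by rewrite big_ord1 /= lerDl.
- by rewrite !big_ord_recl /= big1 ?addr0.
Qed.

Lemma covers_flat d (K : set 'rV[R]_d.+1) x v : 0 <= v ->
  (forall q, K q -> q ord0 ord0 = x) -> covers K v.
Proof.
move=> v0 Kx.
exists (fun k => Some (pcons x (const_mx (- k%:R)), pcons x (const_mx k%:R))).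
split=> [k i /=|q Kq|n].
- case: (unliftP ord0 i) => [j ->|->]; rewrite ?pcons_head ?pcons_lift ?mxE//.
  by rewrite (@le_trans _ _ 0)// oppr_le0.
- pose S := \sum_i `|ptail q ord0 i|.
  exists (Num.truncn S).+1 => //=; rewrite -[q]pconsK; apply/box_pcons.
  rewrite !pcons_head !ptail_pcons (Kx q Kq) lexx; split=> // i.
  have qS : `|q ord0 (lift ord0 i)| <= S.
    by rewrite /S (bigD1 i)//= mxE lerDl sumr_ge0.
  by rewrite !mxE -ler_norml (le_trans qS)// ltW// truncnS_gt.
- rewrite big1// => k _; rewrite /= box_vol_pcons !pcons_head subrr mul0r//.
Qed.

Lemma covers_cone_null d (K : set 'rV[R]_d.+1) (x y0 M alpha beta : R) :
  cvx K -> sec K y0 !=set0 -> x != y0 -> alpha <= beta ->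
  (forall y, alpha <= y <= beta -> 1 <= (y - y0) / (x - y0) <= M) ->
  (forall eps, 0 < eps -> covers (sec K x) eps) -> forall eps, 0 < eps ->
  covers (K `&` [set q | alpha <= q ord0 ord0 <= beta]) eps.
Proof.
move=> cK K0 xy ab hM Kx eps eps0.
have M0 : 0 <= M.
  have /andP[h] : 1 <= (alpha - y0) / (x - y0) <= M by apply: hM; rewrite lexx.
  by apply: le_trans; apply: le_trans h.
pose Q := (beta - alpha) * M ^+ d.
have Q0 : 0 <= Q by rewrite mulr_ge0 ?subr_ge0 ?exprn_ge0.
have e1 : 0 < eps / (2 * (Q + 1)) by rewrite divr_gt0// mulr_gt0//; lra.
have e2 : 0 < eps / 2 by rewrite divr_gt0.
apply: (covers_le _ _ (covers_cone cK K0 xy ab hM (Kx _ e1) e2)) => //.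
rewrite mulrA -/Q; suff : Q * (eps / (2 * (Q + 1))) <= eps / 2 by lra.
have -> : eps / 2 = (Q + 1) * (eps / (2 * (Q + 1))).
  by field; rewrite gt_eqF//; lra.
by rewrite ler_wpM2r ?(ltW e1)// lerDl.
Qed.

(** Consider the levels with nonempty sections. If their extent [l] is finite and positive, take two
    of them, [u1] and [u2], more than [l / 2] apart: the section at their midpoint [x] is not fat,
    hence has a cheap cover by induction, and on each side of [x] the set lies in a cone over this
    section. If the extent is infinite, the section at [x] is null and so are all pieces of the
    cones. *)
Lemma covers_of_not_fat d : exists2 C : R, 0 < C &
  forall (K : set 'rV[R]_d) V, cvx K -> 0 < V -> ~ fat K V ->
    forall eps, 0 < eps -> covers K (C * V + eps).
Proof.
elim: d => [|d [C C0 IH]].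
  exists 1 => // K V _ V0 nf eps eps0; rewrite mul1r.
  have [K0|K0] := pselect (K !=set0); last first.
    apply: (@covers_le _ _ set0 _ 0); [|lra|exact: covers_set0].
    by move=> z Kz; apply: K0; exists z.
  have V1 : 1 <= V by rewrite leNgt; apply/negP => /ltW V1; apply: nf.
  exists (fun k => if (k < 1)%N then Some (0, 0) else None); split.
  - by move=> k; case: ifP => //= _ i.
  - by move=> z _; exists 0%N => //= -[].
  move=> n; apply: (@le_trans _ _ (1%:R * 1)); last by lra.
  apply: le_trans (sum_initial_le n 1 ler01); apply: ler_sum => k _.
  by case: ifP => //= _; rewrite /box_vol big_ord0.
pose P2 : R := 2 ^+ d.+1; have P20 : 0 < P2 by rewrite exprn_gt0.
pose P4 : R := 4 ^+ d; have P40 : 0 < P4 by rewrite exprn_gt0.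
(* Two sides; cone ratio at most 4, hence [P4]; and [W * l <= 2 * P2 * V] for the section at [x]. *)
exists (2 * (P4 * (C * (2 * P2)))); first by rewrite !mulr_gt0.
move=> K V cK V0 nf eps eps0.
set C' := 2 * _; have C'V : 0 < C' * V by rewrite !mulr_gt0.
pose P y := sec K y !=set0.
have KP q : K q -> P (q ord0 ord0) by exists (ptail q); rewrite /sec/= pconsK.
have [[y1 [y2 [y12 Py1 Py2]]]|flat] := pselect (exists y1 y2,
    [/\ y1 < y2, P y1 & P y2]); last first.
  have [[q0 Kq0]|K0] := pselect (K !=set0); last first.
    apply: (@covers_le _ _ set0 _ 0); [|lra|exact: covers_set0].
    by move=> z Kz; apply: K0; exists z.
  apply: (@covers_flat _ _ (q0 ord0 ord0)); first by lra.
  move=> q Kq; apply/eqP/contraT; rewrite neq_lt => h; exfalso; apply: flat.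
  by case/orP: h => h; [exists (q ord0 ord0), (q0 ord0 ord0)|
    exists (q0 ord0 ord0), (q ord0 ord0)]; split=> //; exact: KP.
have small y y' x e : P y -> P y' -> y < x < y' -> 0 < e ->
    covers (sec K x) (C * (P2 * V / (y' - y)) + e).
  move=> Py Py' yxy' e0; apply: IH => //; first exact: cvx_sec.
    by rewrite divr_gt0 ?mulr_gt0//; lra.
  exact: not_fat_sec nf yxy' Py Py'.
have [[L PL]|unb] :=
  pselect (exists L, forall y y', P y -> P y' -> y' - y <= L).
  pose S : set R := [set t | exists y y', [/\ P y, P y' & t = y' - y]].
  have S0 : has_sup S.
    split; first by exists (y2 - y1), y1, y2.
    by exists L => _ [y [y' [Py Py' ->]]]; exact: PL.
  pose l := sup S.
  have Pl y y' : P y -> P y' -> y' - y <= l.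
    by move=> Py Py'; apply: sup_upper_bound => //; exists y, y'.
  have l0 : 0 < l by have := Pl _ _ Py1 Py2; lra.
  have [||_ [u1 [u2 [Pu1 Pu2 ->]]] hu] := @sup_adherent R S (l / 2).
  - by rewrite divr_gt0.
  - by [].
  rewrite -/l in hu; have ul := Pl _ _ Pu1 Pu2.
  pose x := (u1 + u2) / 2; pose W := P2 * V / (u2 - u1).
  have Wl : W * l <= 2 * P2 * V.
    rewrite /W mulrAC ler_pdivrMr; last by lra.
    have : 0 < P2 * V by rewrite mulr_gt0.
    nra.
  pose e1 := eps / (4 * (l * P4)).
  have e10 : 0 < e1 by rewrite divr_gt0// !mulr_gt0.
  have e20 : 0 < eps / 4 by rewrite divr_gt0.
  have := small _ _ x _ Pu1 Pu2 _ e10; rewrite -/W => Kx.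
  have {}Kx : covers (sec K x) (C * W + e1) by apply: Kx; rewrite /x; lra.
  have right := @covers_cone R d K x u1 4 x (u1 + l) _ (eps / 4) cK Pu1 _ _ _
    Kx e20.
  have left := @covers_cone R d K x u2 4 (u2 - l) x _ (eps / 4) cK Pu2 _ _ _
    Kx e20.
  have half a b : b - a <= l ->
      (b - a) * (P4 * (C * W + e1)) + eps / 4 <= C' * V / 2 + eps / 2.
    move=> bal; have CWe : 0 <= P4 * (C * W + e1).
      by rewrite mulr_ge0 ?(ltW P40)// (covers_ge0 Kx).
    have := ler_wpM2r CWe bal.
    have -> : l * (P4 * (C * W + e1)) = P4 * C * (W * l) + eps / 4.
      by rewrite /e1; field; rewrite !gt_eqF.
    have : P4 * C * (W * l) <= P4 * C * (2 * P2 * V).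
      by rewrite ler_wpM2l// mulr_ge0// ltW.
    rewrite /C'; lra.
  apply: (@covers_le _ _ ((K `&` [set q | x <= q ord0 ord0 <= u1 + l]) `|`
    (K `&` [set q | u2 - l <= q ord0 ord0 <= x])) _
    ((C' * V / 2 + eps / 2) + (C' * V / 2 + eps / 2))).
  - move=> q Kq; have Pq := KP q Kq.
    have h1 := Pl _ _ Pu1 Pq; have h2 := Pl _ _ Pq Pu2.
    have [xq|qx] := leP x (q ord0 ord0); [left|right]; split=> //=.
      by rewrite xq; lra.
    by rewrite (ltW qx) andbT; lra.
  - by lra.
  apply: covers_setU.
    apply: covers_le (right _ _ _) => //.
    - by apply: half; rewrite /x; lra.
    - by rewrite gt_eqF// /x; lra.
    - by rewrite /x; lra.
    move=> y /andP[xy yu]; have xu1 : 0 < x - u1 by rewrite /x; lra.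
    by rewrite ler_pdivlMr// ler_pdivrMr//; apply/andP; rewrite /x in xy *; lra.
  apply: covers_le (left _ _ _) => //.
  - by apply: half; rewrite /x; lra.
  - by rewrite lt_eqF// /x; lra.
  - by rewrite /x; lra.
  move=> y /andP[xy yu]; have xu1 : 0 < u2 - x by rewrite /x; lra.
  rewrite -mulrNN -invrN !opprB.
  by rewrite ler_pdivlMr// ler_pdivrMr//; apply/andP; rewrite /x in yu *; lra.
apply: (@covers_le _ _ K _ eps) => //; first by lra.
pose x := (y1 + y2) / 2.
(* The distance of two nonempty levels around [x] can be made arbitrarily large, so the bound of
   [small] tends to 0. *)
have Kx e : 0 < e -> covers (sec K x) e.
  move=> e0; pose W := e / (2 * C).
  have W0 : 0 < W by rewrite divr_gt0// mulr_gt0.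
  have [y [y' [Py Py' hL]]] : exists y y', [/\ P y, P y' & P2 * V / W < y' - y].
    apply: contrapT => h; apply: unb; exists (P2 * V / W) => y y' Py Py'.
    by rewrite leNgt; apply/negP => ?; apply: h; exists y, y'.
  have [u1 [Pu1 u1y u1y1]] : exists u, [/\ P u, u <= y & u <= y1].
    by have [?|?] := leP y y1; [exists y|exists y1; split=> //; exact: ltW].
  have [u2 [Pu2 u2y u2y2]] : exists u, [/\ P u, y' <= u & y2 <= u].
    by have [?|?] := leP y' y2; [exists y2|exists y'; split=> //; exact: ltW].
  have e20 : 0 < e / 2 by rewrite divr_gt0.
  have uxu : u1 < x < u2 by rewrite /x; lra.
  apply: covers_le (small _ _ x _ Pu1 Pu2 uxu e20) => //.
  suff : C * (P2 * V / (u2 - u1)) <= e / 2 by lra.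
  have -> : e / 2 = C * W by rewrite /W; field; rewrite gt_eqF.
  rewrite ler_wpM2l ?(ltW C0)// ler_pdivrMr; last by lra.
  rewrite [W * _]mulrC -ler_pdivrMr//; lra.
pose A n := (K `&` [set q | x <= q ord0 ord0 <= x + n.+1%:R]) `|`
  (K `&` [set q | x - n.+1%:R <= q ord0 ord0 <= x]).
have xy1 : 0 < x - y1 by rewrite /x; lra.
have xy2 : 0 < y2 - x by rewrite /x; lra.
apply: (@covers_le _ _ (\bigcup_n A n) _ _ _ _ (lexx _)).
  move=> q Kq; have [xq|qx] := leP x (q ord0 ord0).
    exists (Num.truncn (q ord0 ord0 - x)) => //; left; split=> //=.
    by rewrite xq -lerBlDl ltW// truncnS_gt.
  exists (Num.truncn (x - q ord0 ord0)) => //; right; split=> //=.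
  by rewrite (ltW qx) andbT lerBlDr -lerBlDl ltW// truncnS_gt.
apply: (@covers_bigcup _ _ _ (fun n => eps * 2^-1 ^+ n.+1)) => [n|n].
  have en : 0 < eps * 2^-1 ^+ n.+1 / 2.
    by rewrite divr_gt0// mulr_gt0// exprn_gt0.
  rewrite [eps * _](_ : _ = eps * 2^-1 ^+ n.+1 / 2 + eps * 2^-1 ^+ n.+1 / 2);
    last by field.
  have n0 : 0 <= n.+1%:R :> R by [].
  apply: covers_setU.
    apply: (@covers_cone_null _ _ x y1 ((x + n.+1%:R - y1) / (x - y1))) => //.
    - by rewrite gt_eqF//; lra.
    - by rewrite lerDl.
    by move=> y /andP[? ?]; rewrite ler_pdivlMr// ler_pM2r ?invr_gt0//; lra.
  apply: (@covers_cone_null _ _ x y2 ((y2 - (x - n.+1%:R)) / (y2 - x))) => //.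
  - by rewrite lt_eqF//; lra.
  - by rewrite gerBl.
  move=> y /andP[? ?]; rewrite -[_ / (x - y2)]mulrNN -invrN !opprB.
  by rewrite ler_pdivlMr// ler_pM2r ?invr_gt0//; lra.
by rewrite -mulr_sumr sum_geometric_half ler_piMr ?(ltW eps0)// gerBl exprn_ge0.
Qed.

(** [None] is turned into a one-point box, whose volume is 0 only in positive dimension. *)
Lemma vol_covers d (A : set 'rV[R]_d.+1) v : covers A v -> (vol A <= v%:E)%E.
Proof.
move=> [B [Bwf AB Bv]].
pose ab k := if B k is Some ab then ab else (0, 0).
have abv k : box_vol (ab k).1 (ab k).2 = obox_vol (B k).
  rewrite /ab; case: (B k) => //=.
  by rewrite box_vol_pcons mxE subrr mul0r.
apply: (@le_trans _ _ (\sum_(0 <= k <oo) (box_vol (ab k).1 (ab k).2)%:E)%E).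
  apply: ereal_inf_lbound; exists ab => //; split.
    by move=> k i; rewrite /ab; have := Bwf k; case: (B k).
  move=> q /AB[k _ Bq]; exists k => //; move: Bq; rewrite /ab.
  by case: (B k).
apply: lime_le.
  apply: is_cvg_nneseries => k _ _; rewrite lee_fin abv.
  exact: obox_vol_ge0.
near=> n; rewrite sumEFin lee_fin big_mkord.
by under eq_bigr do rewrite abv.
Unshelve. all: by end_near. Qed.

Lemma fat_of_vol d : exists2 c : R, 0 < c &
  forall K : set 'rV[R]_d.+1, cvx K -> (1%:E <= vol K)%E -> fat K c.
Proof.
have [C C0 h] := covers_of_not_fat d.+1.
have c0 : 0 < (2 * C)^-1 by rewrite invr_gt0 mulr_gt0.
(* With [eps = 1 / 4] a set that is not fat would have volume at most [1 / 2 + 1 / 4 < 1]. *)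
exists (2 * C)^-1 => // K cK volK; apply: contrapT => nf.
have e0 : 0 < 4^-1 :> R by rewrite invr_gt0.
have := le_trans volK (vol_covers (h K _ cK c0 nf _ e0)).
have -> : C * (2 * C)^-1 = 2^-1 by field; rewrite gt_eqF.
rewrite lee_fin; lra.
Qed.

End FatOfVolume.

(** * From volumes to fatness *)

Section Assembly.
Variable R : realType.
Local Notation dens := (dens R).

Lemma cvx_convex_set d (K : set 'rV[R]_d) :
  convex_set (K : set (convex_lmodType 'rV[R]_d)) -> cvx K.
Proof.
move=> cK p q l /andP[l0 l1] Kp Kq.
have := cK q p (Itv01 l0 l1) (mem_set Kq) (mem_set Kp).
by move=> /set_mem; rewrite addrC.
Qed.

(** After multiplication by [q!], factors compare one by one: [n * (q - i) <= (n - i) * q]. *)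
Lemma expn_le_bin n q : (q <= n)%N -> (n ^ q <= 'C(n, q) * q ^ q)%N.
Proof.
move=> qn; rewrite -(leq_pmul2r (fact_gt0 q)) mulnAC bin_ffact -ffactnn.
rewrite !ffact_prod -[X in (n ^ X)%N]card_ord -[X in (_ * q ^ X)%N]card_ord.
rewrite -!prod_nat_const -!big_split/=; apply: leq_prod => i _.
have iq := ltn_ord i.
by rewrite mulnBr mulnBl leq_sub2l// mulnC leq_mul2r qn orbT.
Qed.

(** Every good [q]-subset is the image of a good word, its enumeration; so there are at least as
    many good words as good subsets. *)
Lemma card_uniform_family d n q (F : 'I_n -> set 'rV[R]_d)
    (Good : set 'rV[R]_d -> Prop) (alpha : R) : (0 < q <= n)%N -> 0 <= alpha ->
  alpha * 'C(n, q)%:R <= #|[set S : {set 'I_n} | (#|S| == q) &&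
    `[< Good (bigcapS F S) >]]|%:R ->
  alpha / (q ^ q)%:R <= dens (fun T : {ffun 'I_q -> 'I_n} =>
    `[< Good (cap (fun=> F) [set: 'I_q]%SET T) >]).
Proof.
move=> /andP[q0 qn] alpha0 hC.
have n0 : (0 < n)%N by exact: leq_trans qn.
rewrite dens_bound ?card_ffun ?card_ord ?expn_gt0 ?n0//.
apply: (@le_trans _ _ (alpha * 'C(n, q)%:R)).
  rewrite -mulrA ler_wpM2l// mulrC ler_pdivrMr ?ltr0n ?expn_gt0 ?q0//.
  by rewrite -natrM ler_nat expn_le_bin.
apply: (le_trans hC); rewrite ler_nat.
pose P (T : {ffun 'I_q -> 'I_n}) :=
  `[< Good (cap (fun=> F) [set: 'I_q]%SET T) >].
have := leq_imset_card
  (fun T : {ffun 'I_q -> 'I_n} => [set T i | i : 'I_q]%SET) P.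
apply: leq_trans; apply: subset_leq_card; apply/fintype.subsetP => S.
rewrite inE => /andP[/eqP Sq /asboolP GS].
pose T := [ffun i : 'I_q => nth (Ordinal n0) (enum S) i].
have TS : [set T i | i : 'I_q]%SET = S.
  apply/setP => x; apply/imsetP/idP => [[i _ ->]|xS].
    by rewrite ffunE -mem_enum mem_nth// -cardE Sq.
  have xq : (index x (enum S) < q)%N by rewrite -Sq cardE index_mem mem_enum.
  by exists (Ordinal xq); rewrite // ffunE nth_index// mem_enum.
apply/imsetP; exists T => //; rewrite /P; apply/asboolP.
suff -> : cap (fun=> F) [set: 'I_q]%SET T = bigcapS F S by [].
apply/seteqP; split=> p Fp.
  move=> x /= ; rewrite -TS => /imsetP[i _ ->].
  by apply: Fp; rewrite finset.inE.
by move=> i _; apply: Fp => /=; rewrite -TS; apply/imsetP; exists i.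
Qed.

Lemma dens_coord m (i : 'I_m) (X : finType) (P : pred X) : (0 < #|X|)%N ->
  dens (fun T : {ffun 'I_m -> X} => P (T i)) = dens P.
Proof.
move=> X0; have i_inj : injective (fun _ : unit => i) by move=> [] [].
have tt_bij : bijective (fun f : {ffun unit -> X} => f tt).
  exists (fun x => [ffun=> x]) => [f|x]; last by rewrite ffunE.
  by apply/ffunP => -[]; rewrite ffunE.
rewrite -(dens_bij R P tt_bij) -(dens_comp R i_inj _ X0).
by congr (dens _); apply/funext => T; rewrite ffunE.
Qed.

End Assembly.

Unset Implicit Arguments.
Set Strict Implicit.

Theorem theorem2 (R : realType) (d : nat) (d_gt0 : (0 < d)%N) :
  exists2 v : R, 0 < v &
  forall alpha : R, 0 < alpha < 1 ->
  exists2 beta : R, 0 < beta &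
  forall (n : nat) (F : 'I_n -> set 'rV[R]_d),
    (d.+1 <= n)%N ->
    (forall i, convex_set (F i : set (convex_lmodType 'rV[R]_d))) ->
    alpha * ('C(n, d.+1))%:R <=
      (#|[set S : {set 'I_n} | (#|S| == d.+1)%N &&
                               `[< (1%:E <= vol (bigcapS F S))%E >]]|)%:R ->
    exists S : {set 'I_n},
      beta * n%:R <= (#|S|)%:R /\ (v%:E <= vol (bigcapS F S))%E.
Proof.
pose m := (2 ^ d)%N; have m0 : (0 < m)%N by rewrite expn_gt0.
have [c1 c10 fatvol] : exists2 c : R, 0 < c &
    forall K : set 'rV[R]_d, cvx K -> (1%:E <= vol K)%E -> fat K c.
  by case: d d_gt0 {m m0} => // d _; exact: fat_of_vol.
have [t [c2 [c20 mt cls]]] := fat_class R d (ltn0Sn d) m.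
have [c3 c30 common] := fat_common R d m0.
have [c4 c40 volfat] := vol_fat_ge R d.
(* All four constants are chosen before [alpha], so they depend on [d] only. *)
exists (c4 * (c3 * (c2 * c1))); first by rewrite !mulr_gt0.
move=> alpha /andP[alpha0 _].
have t0 : (0 < t)%N by exact: leq_trans mt.
have g10 : 0 < alpha / (d.+1 ^ d.+1)%:R by rewrite divr_gt0// ltr0n expn_gt0.
have [g2 g20 blow] := dens_blowup 'I_d.+1 (Ordinal t0) g10.
(* The class and the [m] members given by [fat_class] vary with the configuration [w]; a pigeonhole
   over [C] fixes them for a positive proportion of [w]. *)
pose C := ('I_d.+1 * {ffun 'I_m -> 'I_t})%type.
have C0 : (0 < #|{: C}|)%N.
  by rewrite card_prod card_ffun !card_ord muln_gt0 expn_gt0 t0.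
have g30 : 0 < g2 / #|{: C}|%:R by rewrite divr_gt0// ltr0n.
have [beta beta0 hbeta] := common _ g30.
exists beta => // n F dn cF hF.
have {}cF i : cvx (F i) by exact: cvx_convex_set.
have n0 : (0 < #|'I_n|)%N by rewrite card_ord (leq_trans _ dn).
pose G (T : {ffun 'I_d.+1 -> 'I_n}) :=
  `[< fat (cap (fun=> F) [set: 'I_d.+1]%SET T) c1 >].
have dG : alpha / (d.+1 ^ d.+1)%:R <= dens R G.
  have qn : (0 < d.+1 <= n)%N by [].
  have := @card_uniform_family R d n d.+1 F (fun K => (1%:E <= vol K)%E) alpha
    qn (ltW alpha0) hF.
  move=> /le_trans; apply; apply: dens_le => T /asboolP volT.
  apply/asboolP; apply: fatvol => //.
  exact: cvx_cap.
have dw := blow _ G n0 dG.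
pose G2 (U : {ffun 'I_m -> 'I_n}) :=
  `[< fat (cap (fun=> F) [set: 'I_m]%SET U) (c2 * c1) >].
have [|[k e] /= ke] := @dens_pigeon R _ C _ (fun (c : C)
    (w : {ffun 'I_t * 'I_d.+1 -> 'I_n}) => injectiveb c.2 &&
    G2 [ffun j => w (c.2 j, c.1)]) (lt_le_trans g20 dw).
  move=> w /forallP Gw.
  have [|||k [e [e_inj fe]]] := cls (fun i y => F (w (y, i)))
    [set: 'I_d.+1]%SET c1 _ _ c10.
  - by move=> *; exact: cF.
  - by rewrite cardsT card_ord.
  - move=> T; have /asboolP := Gw T; apply: fat_le => // p Fp i iT.
    by have := Fp i iT; rewrite ffunE.
  exists (k, [ffun j => e j]) => /=; apply/andP; split.
    by apply/injectiveP => j j'; rewrite !ffunE => /e_inj.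
  by apply/asboolP; apply: fat_le fe => // p Fp j _; rewrite !ffunE; exact: Fp.
have C'0 : 0 <= (#|{: C}|%:R)^-1 :> R by rewrite invr_ge0.
have {}ke := le_trans (ler_wpM2r C'0 dw) ke.
have e_inj : injective e.
  by have [w /andP[/injectiveP]] := dens_gt0 (lt_le_trans g30 ke).
have b_inj : injective (fun j => (e j, k)) by move=> j j' [/e_inj].
(* The letters at the distinct positions [(e j, k)] form a uniform [m]-tuple, so a positive
   proportion of [m]-tuples is fat. *)
have dG2 : g2 / #|{: C}|%:R <= dens R G2.
  rewrite -(dens_comp R b_inj G2 n0).
  by apply: (le_trans ke); apply: dens_le => w /andP[].
have [||A' [P [cA' _ fP dP]]] := hbeta 'I_n (fun=> F) (c2 * c1)
  [set: 'I_m]%SET G2 n0 (fun _ => cF) _ dG2.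
- by rewrite mulr_gt0.
- by move=> U /asboolP.
(* Fewer than [2 ^ d = m] indices were lost, so one survives. The entry at [i0] of a uniform tuple
   is a uniform member of the family, and it contains [P] with probability at least [beta]. *)
have /card_gt0P[i0 i0A'] : (0 < #|A'|)%N.
  by move: cA'; rewrite cardsT card_ord -/m -[X in (X < _)%N]add0n ltn_add2r.
pose S := [set x | `[< P `<=` F x >]]%SET.
have PS : P `<=` bigcapS F S.
  by move=> p Pp x /=; rewrite finset.inE => /asboolP; exact.
exists S; split.
  have -> : #|S| = #|[pred x | `[< P `<=` F x >]]|.
    by apply: eq_card => x; rewrite !inE.
  rewrite -[n in n%:R]card_ord -dens_bound// -(dens_coord R i0)//.
  apply: (le_trans dP); apply: dens_le => T /andP[_ /asboolP h].
  by apply/asboolP; exact: h.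
apply: volfat; first by apply: cvx_bigcap.
  by rewrite !mulr_ge0 ?(ltW c30) ?(ltW c20) ?(ltW c10).
exact: fat_le fP.
Qed.
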